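(* Let $d\mu(x)=e^{-V(x)}dx$ be a probability measure on $\mathbb R^d$ such that $\int_{\mathbb R^d}e^{\eta|x|^\alpha}d\mu(x)<+\infty$ for some $\eta>0$, $\alpha\in(1,2]$. Let $\tau=2/\alpha^*\in(0,1]$. Assume that $V$ is twice continuously differentiable and bounded from below and that there exist $s>0$, $t\in(0,1)$ such that for some constant $C=C(s,t)$ one has $$s\max(V,1)^\tau\le(1-t)|\nabla V|^2-\Delta V+C.$$ Then $\mu$ satisfies Inequality $I(\tau)$.
   Context: $\frac1\alpha+\frac1{\alpha^*}=1$. $\mu$ satisfies Inequality $I(\tau)$ if there exist constants $B,C'$ such that for every smooth $f$, $\mathrm{Ent}_\mu(f^2)\le B\int f^2d\mu+C'\int|\nabla f|^2\log^{1-\tau}\left(e+\frac{f^2}{\int f^2d\mu}\right)d\mu$, where $\mathrm{Ent}_\mu(f^2)=\int f^2\log\left(f^2/\int f^2d\mu\right)d\mu$. *)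

(* Defs.v *)
From HB Require Import structures.
From mathcomp Require Import all_boot all_order all_algebra.
From mathcomp Require Import all_classical all_reals all_analysis.
Set Implicit Arguments.
Unset Strict Implicit.
Unset Printing Implicit Defensive.
Import Order.TTheory GRing.Theory Num.Theory.
Import numFieldNormedType.Exports.

Local Open Scope classical_set_scope.
Local Open Scope ring_scope.

Definition rV_display : measure_display.
Proof. exact: default_measure_display. Qed.

Definition rVcoord (R : realType) (d : nat) (i : 'I_d) (x : 'rV[R]_d)
  : measurableTypeR R := x ord0 i.

Section measurable_rV.
Context (R : realType) (d : nat).

Let rV_set0 : g_sigma_preimage (@rVcoord R d) set0.
Proof. exact: sigma_algebra0. Qed.

Let rV_setC A :
  g_sigma_preimage (@rVcoord R d) A -> g_sigma_preimage (@rVcoord R d) (~` A).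
Proof. exact: sigma_algebraC. Qed.

Let rV_bigcup (F : (set 'rV[R]_d)^nat) :
  (forall i, g_sigma_preimage (@rVcoord R d) (F i)) ->
  g_sigma_preimage (@rVcoord R d) (\bigcup_i (F i)).
Proof. exact: sigma_algebra_bigcup. Qed.

(* R^d carries the product sigma-algebra, generated by the coordinates; it
   coincides with the Borel sigma-algebra. *)
HB.instance Definition _ := @isMeasurable.Build rV_display
  'rV[R]_d (g_sigma_preimage (@rVcoord R d)) rV_set0 rV_setC rV_bigcup.

End measurable_rV.

Lemma measurable_rVcoord (R : realType) (d : nat) (i : 'I_d) :
  measurable_fun [set: 'rV[R]_d] (@rVcoord R d i).
Proof.
move=> _ Y mY; rewrite setTI; apply: sub_sigma_algebra => /=.
rewrite -bigcup_seq/=; exists i => /=; first by rewrite mem_index_enum.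
by exists Y => //; rewrite setTI.
Qed.

Lemma measurable_fun_rV (R : realType) (d : nat) d1 (T : measurableType d1)
    (f : T -> 'rV[R]_d) :
  (forall i, measurable_fun [set: T] (@rVcoord R d i \o f)) ->
  measurable_fun [set: T] f.
Proof.
move=> mf _ Y mY; rewrite setTI.
have sF : sigma_algebra setT [set A : set 'rV[R]_d | measurable (f @^-1` A)].
  split => [|A mA|F mF] /=.
  - by rewrite preimage_set0.
  - by rewrite setTD preimage_setC; exact: measurableC.
  - rewrite preimage_bigcup; apply: bigcupT_measurable => n; exact: mF.
apply: (smallest_sub sF _ mY) => A; rewrite -bigcup_seq => -[i _ [B mB <-]].
by rewrite /= setTI -comp_preimage -[X in measurable X]setTI; exact: mf.
Qed.

Definition rVcons (R : realType) (d : nat) (p : measurableTypeR R * 'rV[R]_d)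
  : 'rV[R]_d.+1 := row_mx (p.1 : R)%:M p.2.

Lemma rVcoord_cons0 (R : realType) (d : nat) (p : measurableTypeR R * 'rV[R]_d) :
  rVcoord ord0 (rVcons p) = p.1.
Proof.
rewrite /rVcoord /rVcons.
have -> : (ord0 : 'I_(1 + d)) = lshift d ord0 by exact/val_inj.
by rewrite (@row_mxEl R 1 1 d) mxE eqxx mulr1n.
Qed.

Lemma rVcoord_consS (R : realType) (d : nat) (p : measurableTypeR R * 'rV[R]_d)
    (i : 'I_d) :
  rVcoord (lift ord0 i) (rVcons p) = rVcoord i p.2.
Proof.
rewrite /rVcoord /rVcons.
have -> : (lift ord0 i : 'I_(1 + d)) = rshift 1 i by exact/val_inj.
by rewrite (@row_mxEr R 1 1 d).
Qed.

Lemma measurable_rVcons (R : realType) (d : nat) :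
  measurable_fun [set: measurableTypeR R * 'rV[R]_d] (@rVcons R d).
Proof.
apply: measurable_fun_rV => i; case: (unliftP ord0 i) => [j ->|->].
- rewrite (_ : _ \o _ = @rVcoord R d j \o snd); last first.
    by apply/funext => p /=; rewrite rVcoord_consS.
  by apply: measurableT_comp => //; exact: measurable_rVcoord.
- rewrite (_ : _ \o _ = fst) //.
  by apply/funext => p /=; rewrite rVcoord_cons0.
Qed.

Section lebesgue_rV_step.
Context (R : realType) (d : nat).
Variable m : {sigma_finite_measure set 'rV[R]_d -> \bar R}.

Definition lebesgue_rVS : set 'rV[R]_d.+1 -> \bar R :=
  pushforward (lebesgue_measure \x m)%E (@rVcons R d).

Let lebesgue_rVS0 : lebesgue_rVS set0 = 0%E.
Proof. by rewrite /lebesgue_rVS /pushforward preimage_set0 measure0. Qed.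

Let lebesgue_rVS_ge0 A : (0 <= lebesgue_rVS A)%E.
Proof. exact: (measure_ge0 (lebesgue_measure \x m)%E). Qed.

Let lebesgue_rVS_sigma_additive : semi_sigma_additive lebesgue_rVS.
Proof.
have mp A : measurable A -> measurable (@rVcons R d @^-1` A).
  by move=> mA; rewrite -[X in measurable X]setTI; exact: measurable_rVcons.
move=> F mF tF mUF; rewrite /lebesgue_rVS /pushforward preimage_bigcup.
apply: (@measure_semi_sigma_additive _ _ _ (lebesgue_measure \x m)%E).
- by move=> n; exact: mp.
- apply/trivIsetP => i j _ _ ij; rewrite -preimage_setI.
  by move/trivIsetP : tF => /(_ _ _ _ _ ij) ->//; rewrite preimage_set0.
- by rewrite -preimage_bigcup; exact: mp.
Qed.

HB.instance Definition _ := isMeasure.Build _ _ _ lebesgue_rVS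
  lebesgue_rVS0 lebesgue_rVS_ge0 lebesgue_rVS_sigma_additive.

Let rVuncons (x : 'rV[R]_d.+1) : measurableTypeR R * 'rV[R]_d :=
  (rVcoord ord0 x, \row_i x ord0 (lift ord0 i)).

Let rVconsK : cancel (@rVcons R d) rVuncons.
Proof.
move=> [a v]; congr pair; first exact: rVcoord_cons0.
by apply/rowP => i; rewrite mxE; exact: rVcoord_consS.
Qed.

Let measurable_rVuncons : measurable_fun [set: 'rV[R]_d.+1] rVuncons.
Proof.
apply/measurable_fun_pairP; split; first exact: measurable_rVcoord.
apply: measurable_fun_rV => i.
rewrite (_ : _ \o _ = @rVcoord R d.+1 (lift ord0 i)); first exact: measurable_rVcoord.
by apply/funext => x; rewrite /rVcoord /= mxE.
Qed.

Lemma lebesgue_rVS_sigma_finite : sigma_finite [set: 'rV[R]_d.+1] lebesgue_rVS.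
Proof.
have /sigma_finiteP[F [TF ndF Foo]] :=
  sigma_finiteT (lebesgue_measure : {sigma_finite_measure set (measurableTypeR R) -> \bar R}).
have /sigma_finiteP[G [TG ndG Goo]] := sigma_finiteT m.
exists (fun n => rVuncons @^-1` (F n `*` G n)).
  rewrite -preimage_bigcup (_ : \bigcup_n _ = setT) ?preimage_setT//.
  rewrite -setXTT TF TG predeqE => -[x y]; split.
    by move=> [n _ []/= ? ?]; split; exists n.
  move=> [/= [n _ Fnx] [k _ Gky]]; exists (maxn n k) => //; split.
  - by move: x Fnx; exact/subsetPset/ndF/leq_maxl.
  - by move: y Gky; exact/subsetPset/ndG/leq_maxr.
move=> n; have [mFn Fnoo] := Foo n; have [mGn Gnoo] := Goo n; split.
  rewrite -[X in measurable X]setTI; apply: measurable_rVuncons => //.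
  exact: measurableX.
rewrite /lebesgue_rVS /pushforward -comp_preimage.
rewrite (_ : _ \o _ = id); last by apply/funext => p; exact: rVconsK.
by rewrite preimage_id product_measure1E// lte_mul_pinfty// ge0_fin_numE.
Qed.

HB.instance Definition _ :=
  Measure_isSigmaFinite.Build _ _ _ lebesgue_rVS lebesgue_rVS_sigma_finite.

End lebesgue_rV_step.

(* Lebesgue measure on R^d: iterated products of lebesgue_measure, transported
   to row vectors; lebesgue_rV_box gives its value on boxes. *)
Fixpoint lebesgue_rV (R : realType) (d : nat)
    : {sigma_finite_measure set 'rV[R]_d -> \bar R} :=
  if d is n.+1 then lebesgue_rVS (lebesgue_rV R n) else \d_(0 : 'rV[R]_0).

Lemma lebesgue_rV_box (R : realType) (d : nat) (A : 'I_d -> set (measurableTypeR R)) :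
  (forall i, measurable (A i)) ->
  (lebesgue_rV R d [set x | forall i, A i (x ord0 i)] =
   \prod_(i < d) lebesgue_measure (A i))%E.
Proof.
elim: d A => [|n IH] A mA.
  by rewrite big_ord0/= diracE mem_set//; case.
have mB : measurable [set x : 'rV[R]_n | forall i, A (lift ord0 i) (x ord0 i)].
  rewrite (_ : mkset _ = \bigcap_(i in [set: 'I_n]) (@rVcoord R n i @^-1` A (lift ord0 i))); last first.
    by apply/seteqP; split => x /= + i; [move=> /(_ i)|move=> /(_ i I)].
  apply: fin_bigcap_measurable => // i _.
  by rewrite -[X in measurable X]setTI; exact: measurable_rVcoord.
rewrite big_ord_recl -IH// -product_measure1E//.
rewrite /= /lebesgue_rVS /pushforward; congr ((_ \x _)%E _).
apply/seteqP; split=> [p /= Ap|p [/= A0 AS] i].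
- split=> [|i] /=.
    by have := Ap ord0; rewrite -[X in A _ X]/(rVcoord _ _) rVcoord_cons0.
  by have := Ap (lift ord0 i); rewrite -[X in A _ X]/(rVcoord _ _) rVcoord_consS.
- rewrite -[X in A _ X]/(rVcoord _ _).
  by case: (unliftP ord0 i) => [j ->|->]; rewrite ?rVcoord_consS ?rVcoord_cons0; [exact: AS|].
Qed.

(* The library norm `|x| on row vectors is the sup norm. *)
Definition enorm (R : realType) (d : nat) (x : 'rV[R]_d) : R :=
  Num.sqrt (\sum_(i < d) x ord0 i ^+ 2).

Definition partial (R : realType) (d : nat) (i : 'I_d) (f : 'rV[R]_d -> R)
  : 'rV[R]_d -> R := 'D_(delta_mx ord0 i) f.

Definition gradient (R : realType) (d : nat) (f : 'rV[R]_d -> R) (x : 'rV[R]_d)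
  : 'rV[R]_d := \row_(i < d) partial i f x.

Definition laplacian (R : realType) (d : nat) (f : 'rV[R]_d -> R) (x : 'rV[R]_d)
  : R := \sum_(i < d) partial i (partial i f) x.

(* C^k on R^d: all partial derivatives of order at most k exist and are
   continuous. *)
Fixpoint class_C (R : realType) (d k : nat) (f : 'rV[R]_d -> R) : Prop :=
  continuous f /\
  (if k is j.+1 then
     forall i : 'I_d, (forall x, derivable f x (delta_mx ord0 i)) /\
                      class_C j (partial i f)
   else True).

Definition smooth (R : realType) (d : nat) (f : 'rV[R]_d -> R) : Prop :=
  forall k, class_C k f.

(* With the conventions 0 / 0 = 0 and ln 0 = 0, the integrand is 0 wherever g
   vanishes. Since y ln y is bounded below, the integral is well defined in
   ]-oo, +oo] when g is nonnegative with finite integral. *)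
Definition Ent (R : realType) (d : nat) (mu : probability 'rV[R]_d R)
    (g : 'rV[R]_d -> R) : \bar R :=
  let m := fine (\int[mu]_x (g x)%:E)%E in
  (\int[mu]_x (g x * ln (g x / m))%:E)%E.

(* When the integral of f ^+ 2 is infinite, the first term on the right makes
   the inequality void (for B, C' > 0), so no integrability is required. *)
Definition inequality_I (R : realType) (d : nat) (mu : probability 'rV[R]_d R)
    (tau : R) : Prop :=
  exists B C' : R, forall f : 'rV[R]_d -> R, smooth f ->
    let m := (\int[mu]_x (f x ^+ 2)%:E)%E in
    (Ent mu (fun x => (f x ^+ 2)%R) <=
     B%:E * m +
     C'%:E * \int[mu]_x (enorm (gradient f x) ^+ 2 *
       ln (expR 1 + f x ^+ 2 / fine m) `^ (1 - tau))%:E)%E.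

(* Main.v *)
Require Import Defs.
From HB Require Import structures.
From mathcomp Require Import all_boot all_order all_algebra.
From mathcomp Require Import all_classical all_reals all_analysis.
From mathcomp Require Import measurable_realfun ring lra.
Import Order.TTheory GRing.Theory Num.Theory.
Import numFieldNormedType.Exports.
Local Open Scope classical_set_scope.
Local Open Scope ring_scope.
Set Implicit Arguments.
Unset Strict Implicit.
Unset Printing Implicit Defensive.

(** Write M = max(V,1)^tau, L(f) = ln(e + f^2)^(1-tau), and normalise f by
    int f^2 dmu = 1, so that the task is to bound int f^2 ln f^2 dmu by a
    constant plus a multiple of int |grad f|^2 L(f) dmu.

    Everything rests on the pointwise inequality (ln_split below)
      ln(e + f^2) <= 4 ln(1 + f^2 e^(-V)) + 3 L(f) M :
    since f^2 = (f^2 e^(-V)) e^V, a large value of f^2 is due either to a large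
    value of the Lebesgue density f^2 e^(-V), or to a large value of V; in the
    second case ln(e + f^2) is at most a multiple of max(V,1), and raising
    that to the power tau gives the term L(f) M.  Two integrals have to be
    bounded.

    The first, int f^2 ln(1 + f^2 e^(-V)) dmu, is the left-hand side of a
    logarithmic Sobolev inequality for Lebesgue measure applied to
    g = f e^(-V/2) (euclidean_lsi).  Its right-hand side contains |grad g|^2,
    that is |grad f|^2 and f^2 |grad V|^2.  The drift condition controls the
    latter: integrating the divergence of u^2 e^(-V) grad V gives, for u of
    class C^1 with bounded support (drift_lebesgue),
      int u^2 (s M + (t/2) |grad V|^2) dmu
        <= int (|C| u^2 + (2/t) |grad u|^2) dmu.

    The second, int f^2 L(f) M dmu, comes from the same inequality with
    u = f L(f)^(1/2), because |grad u|^2 <= 4 L(f) |grad f|^2.  The term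
    |C| u^2 which it produces is absorbed by s M u^2 / 2 where M is large;
    where M is small V is bounded, so that ln(e + f^2) is bounded by a constant
    plus ln(1 + f^2 e^(-V)), and the first integral takes over
    (low_level_absorb).

    Both inequalities need bounded supports and finite integrals.  They are
    applied to a cutoff of radius 1/eps times a truncation of f L(f)^(1/2) in
    which f^2 inside the logarithm is replaced by f^2 / (1 + eps f^2): the
    logarithm is then O(1/eps) while the cutoff has squared gradient O(eps^2),
    so the error stays bounded by a multiple of f^2 (test_function), and
    Fatou's lemma removes both as eps tends to 0. *)

(** * Borel sets of the space of row vectors *)

Section Borel.
Context {R : realType} {d : nat}.
Implicit Types (f : 'rV[R]_d -> R) (x : 'rV[R]_d).

(** Rational cubes form a countable base of the sup-norm topology, and each of
    them is a finite intersection of preimages under coordinates. *)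
Lemma open_measurable_rV (U : set 'rV[R]_d) : open U -> measurable U.
Proof.
move=> oU.
pose B (p : 'rV[rat]_d * nat) : set 'rV[R]_d :=
  [set x | forall i, `|x ord0 i - ratr (p.1 ord0 i)| < p.2.+1%:R^-1].
have mB p : measurable (B p).
  rewrite (_ : B p = \bigcap_(i in [set: 'I_d]) (@rVcoord R d i @^-1`
     [set r | `|r - ratr (p.1 ord0 i)| < p.2.+1%:R^-1])); last first.
    by apply/seteqP; split => x /= + i; [move=> /(_ i)|move=> /(_ i I)].
  apply: fin_bigcap_measurable => // i _.
  rewrite -[X in measurable X]setTI; apply: measurable_rVcoord => //.
  apply: open_measurable.
  rewrite (_ : mkset _ = ball (ratr (p.1 ord0 i) : R) p.2.+1%:R^-1).
    exact: ball_open.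
  by apply/seteqP; split => r /=; rewrite /ball/= distrC.
pose F n := if unpickle n is Some p then
  (if `[< B p `<=` U >] then B p else set0) else set0.
rewrite (_ : U = \bigcup_n F n).
  apply: bigcupT_measurable => n; rewrite /F.
  by case: unpickle => // p; case: ifP.
apply/seteqP; split => [x Ux|x [n _]]; last first.
  by rewrite /F; case: unpickle => // p; case: asboolP => // BU; exact: BU.
have /nbhs_ballP[e /= e0 eU] : nbhs x U by exact: open_nbhs_nbhs.
have [k] : exists k, 0 + k.+1%:R^-1 < e / 2 by apply: ltr_add_invr; rewrite divr_gt0.
rewrite add0r => ke.
have kp : 0 < k.+1%:R^-1 :> R by rewrite invr_gt0.

have qP i : exists q : rat, `|x ord0 i - ratr q| < k.+1%:R^-1.
  have /rat_in_itvoo[q] : x ord0 i - k.+1%:R^-1 < x ord0 i + k.+1%:R^-1 by rewrite ltrD2l gtrN.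
  by rewrite in_itv/= => ?; exists q; rewrite ltr_distlC.
pose q : 'rV[rat]_d := \row_i projT1 (cid (qP i)).
have xq : B (q, k) x by move=> i /=; rewrite mxE; exact: (projT2 (cid (qP i))).
exists (pickle (q, k)) => //; rewrite /F pickleK.
case: asboolP => // -[] y yq; apply: eU; split => // i j.
rewrite [i]ord1; have := yq j; have := xq j; rewrite /ball /=.
move: kp ke; set c := _^-1 => kp ke; rewrite !ltr_norml.
by move=> /andP[? ?] /andP[? ?]; apply/andP; split; lra.
Qed.

Lemma continuous_measurable_rV f : continuous f ->
  measurable_fun setT f.
Proof.
move=> cf; apply: (measurability _ (RGenOpens.measurableE R)).
move=> _ [_ [a [b ->]] <-]; rewrite setTI.
apply: open_measurable_rV; apply: open_comp; last exact: interval_open.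
by move=> + _; exact: cf.
Qed.

End Borel.

(** * Slices in the first coordinate *)

Section slices.
Context {R : realType}.

(** A directional derivative depends only on the restriction to a line.  This
    serves both to freeze coordinates and to obtain a chain rule for functions
    that are only differentiable along given directions. *)
Lemma derive_line (U W : normedModType R) (f : U -> R) (g : W -> R) x v y w :
  (forall h : R, f (h *: v + x) = g (h *: w + y)) ->
  (derivable f x v <-> derivable g y w) /\ 'D_v f x = 'D_w g y.
Proof.
move=> fg; rewrite /derivable /derive.
have -> : (fun h : R => h^-1 *: ((f \o shift x) (h *: v) - f x)) =
          (fun h : R => h^-1 *: ((g \o shift y) (h *: w) - g y)).
  by apply/funext => h /=; have := fg 0; rewrite !scale0r !add0r fg => ->.
by [].
Qed.

Variable d : nat.
Implicit Types (a : R) (y : 'rV[R]_d) (u : 'rV[R]_d.+1 -> R).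

Lemma rVcons0E a y : rVcons (a, y) ord0 ord0 = a.
Proof. exact: (rVcoord_cons0 (a, y)). Qed.

Lemma rVconsSE a y i : rVcons (a, y) ord0 (lift ord0 i) = y ord0 i.
Proof. exact: (rVcoord_consS (a, y)). Qed.

Lemma rVcons_add0 h a y :
  h *: delta_mx ord0 ord0 + rVcons (a, y) = rVcons (h *: (1 : R) + a, y).
Proof.
apply/rowP => j; case: (unliftP ord0 j) => [i ->|->].
  by rewrite mxE !rVconsSE mxE mxE (_ : lift _ _ == _ = false)// andbF mulr0 add0r.
by rewrite mxE !rVcons0E mxE mxE !eqxx.
Qed.

Lemma rVcons_addS h a y i :
  h *: delta_mx ord0 (lift ord0 i) + rVcons (a, y) =
  rVcons (a, h *: delta_mx ord0 i + y).
Proof.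
apply/rowP => j; case: (unliftP ord0 j) => [k ->|->].
  by rewrite mxE !rVconsSE !mxE (inj_eq (@lift_inj _ _)).
by rewrite mxE !rVcons0E mxE mxE (_ : _ == lift _ _ = false)// andbF mulr0 add0r.
Qed.

Lemma rVcons_continuousl y : continuous (fun a => rVcons (a, y)).
Proof.
move=> a A /nbhs_ballP[e e0 eA]; apply/nbhs_ballP; exists e => //= b ab.
apply: eA; split => // i j; rewrite [i]ord1; case: (unliftP ord0 j) => [k ->|->].
  by rewrite !rVconsSE; exact: ballxx.
by rewrite !rVcons0E.
Qed.

Lemma rVcons_continuousr a : continuous (fun y => rVcons (a, y)).
Proof.
move=> y A /nbhs_ballP[e e0 eA]; apply/nbhs_ballP; exists e => //= z [_ yz].
apply: eA; split => // i j; rewrite [i]ord1; case: (unliftP ord0 j) => [k ->|->].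
  by rewrite !rVconsSE; exact: yz.
by rewrite !rVcons0E; exact: ballxx.
Qed.

End slices.

(** * Continuous functions with bounded support *)

(** Boundedness of the support is expressed with a cube, so that slices of such
    functions inherit the same bound. *)
Definition bsupp {R : realType} {d} (f : 'rV[R]_d -> R) : Prop :=
  continuous f /\ exists r : R, forall x : 'rV[R]_d, (exists i, r < `|x ord0 i|) -> f x = 0.

Section bsupp.
Context {R : realType}.

(** The cube carrying the support is compact, hence the function is bounded, and
    the value of Lebesgue measure on boxes shows that the cube has finite measure. *)
Lemma bsupp_integrable d (f : 'rV[R]_d -> R) : bsupp f ->
  (lebesgue_rV R d).-integrable setT (EFin \o f).
Proof.
move=> [cf [r fr]].
pose A := [set x : 'rV[R]_d | forall i, `[-r, r]%classic (x ord0 i)].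
have cA : compact A by apply: (@rV_compact _ _ (fun=> `[-r, r]%classic)) => i; exact: segment_compact.
have mI : measurable (`[-r, r]%classic : set (measurableTypeR R)).
  exact: measurable_itv.
have mA : measurable A.
  rewrite (_ : A = \bigcap_(i in [set: 'I_d]) (@rVcoord R d i @^-1` `[-r, r]%classic)); last first.
    by apply/seteqP; split => x /= + i; [move=> /(_ i)|move=> /(_ i I)].
  apply: fin_bigcap_measurable => // i _.
  by rewrite -[X in measurable X]setTI; exact: measurable_rVcoord.
have Aoo : (lebesgue_rV R d A < +oo)%E.
  rewrite (@lebesgue_rV_box R d (fun=> `[-r, r]%classic))// ltey_eq; apply/orP; left.
  apply: prode_fin_num => i _; rewrite lebesgue_measure_itv/=.
  by case: ifP.
have mf := continuous_measurable_rV cf.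
suff : (lebesgue_rV R d).-integrable A (EFin \o f).
  move=> /(integrable_mkcond _ mA) h; refine (eq_integrable measurableT _ _ _ h) => x _.
  rewrite patchE /=; case: ifPn => // /negP; rewrite inE => Ax.
  congr EFin; apply/esym/fr; apply: contrapT => /forallNP H; apply: Ax => i.
  by have := H i; rewrite /= in_itv/= -ler_norml => /negP; rewrite -leNgt.
apply: measurable_bounded_integrable => //; first exact: measurable_funTS mf.
have : compact (f @` A).
  by apply: continuous_compact => //; apply: continuous_subspaceT.
move=> /compact_bounded[M [Mr hM]]; exists M; split => // x Mx y Ay.
by apply: (hM x Mx); exists y.
Qed.

Lemma partial_eq0 d (f : 'rV[R]_d -> R) r (i : 'I_d) :
  (forall x : 'rV[R]_d, (exists i, r < `|x ord0 i|) -> f x = 0) ->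
  forall x : 'rV[R]_d, (exists i, r < `|x ord0 i|) -> partial i f x = 0.
Proof.
move=> fr x [j xj].
(* the complement of the cube is open, so f vanishes near x *)
have D0 : is_derive x (delta_mx ord0 i) (cst 0 : 'rV[R]_d -> R) 0.
  exact: is_derive_cst.
rewrite /partial -[RHS](@derive_val _ _ _ _ _ _ _ D0).
have [->|e0] := eqVneq (delta_mx ord0 i : 'rV[R]_d) 0; first by rewrite !derive0.
apply: near_eq_derive => //.
have : open [set y : 'rV[R]_d | r < `|y ord0 j|].
  apply: (@open_comp _ _ (fun y : 'rV[R]_d => `|y ord0 j|) [set t | r < t]) => //.
  by move=> y _; apply: continuous_comp; [exact: coord_continuous|exact: norm_continuous].
rewrite openE => /(_ x xj); apply: filterS => y yj.
by rewrite fr//; exists j.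
Qed.

Lemma bsupp_partial d (f : 'rV[R]_d -> R) (i : 'I_d) :
  bsupp f -> continuous (partial i f) -> bsupp (partial i f).
Proof. by move=> [_ [r fr]] c; split=> //; exists r; exact: partial_eq0. Qed.

Lemma bsupp_slicer d (f : 'rV[R]_d.+1 -> R) a : bsupp f -> bsupp (fun y => f (rVcons (a, y))).
Proof.
move=> [cf [r fr]]; split.
  by move=> y; apply: continuous_comp; [exact: rVcons_continuousr|exact: cf].
by exists r => y [i yi]; apply: fr; exists (lift ord0 i); rewrite rVconsSE.
Qed.

Lemma bsupp_slicel d (f : 'rV[R]_d.+1 -> R) y : bsupp f ->
  continuous (fun a => f (rVcons (a, y))) /\ exists r : R, forall a, r < `|a| -> f (rVcons (a, y)) = 0.
Proof.
move=> [cf [r fr]]; split.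
  by move=> a; apply: continuous_comp; [exact: rVcons_continuousl|exact: cf].
by exists r => a ra; apply: fr; exists ord0; rewrite rVcons0E.
Qed.

Lemma derive_slice0 d (f : 'rV[R]_d.+1 -> R) a y :
  derivable f (rVcons (a, y)) (delta_mx ord0 ord0) ->
  is_derive a (1 : R) (fun b => f (rVcons (b, y))) (partial ord0 f (rVcons (a, y))).
Proof.
move=> df.
have [] := @derive_line R _ _ f (fun b : R => f (rVcons (b, y))) (rVcons (a, y))
  (delta_mx ord0 ord0) a 1.
  by move=> h; rewrite rVcons_add0.
by move=> /iffLR/(_ df) ? Dr; apply: DeriveDef.
Qed.

Lemma derive_sliceS d (f : 'rV[R]_d.+1 -> R) a y i :
  derivable f (rVcons (a, y)) (delta_mx ord0 (lift ord0 i)) ->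
  derivable (fun z => f (rVcons (a, z))) y (delta_mx ord0 i) /\
  partial i (fun z => f (rVcons (a, z))) y = partial (lift ord0 i) f (rVcons (a, y)).
Proof.
move=> df.
have [] := @derive_line R _ _ f (fun z => f (rVcons (a, z))) (rVcons (a, y))
  (delta_mx ord0 (lift ord0 i)) y (delta_mx ord0 i).
  by move=> h; rewrite rVcons_addS.
by move=> /iffLR/(_ df) ? Dr; split.
Qed.

Local Open Scope ereal_scope.

(** Lebesgue measure on R^(d+1) is the image of a product measure; pulling an
    integral back to that product makes the theorems of Tonelli and Fubini
    available.  The next lemma does the same for signed integrands. *)
Lemma ge0_integral_rVS d (f : 'rV[R]_d.+1 -> \bar R) :
  measurable_fun setT f -> (forall x, 0 <= f x) ->
  \int[lebesgue_rV R d.+1]_x f x =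
  \int[lebesgue_measure \x lebesgue_rV R d]_p f (rVcons p).
Proof.
move=> mf f0.
rewrite -(@ge0_integral_pushforward _ _ _ _ R _ (@measurable_rVcons R d)
  (lebesgue_measure \x lebesgue_rV R d) setT f)//.
Qed.

Lemma integral_rVS d (f : 'rV[R]_d.+1 -> R) : bsupp f ->
  (lebesgue_measure \x lebesgue_rV R d).-integrable setT (fun p => (f (rVcons p))%:E) /\
  \int[lebesgue_rV R d.+1]_x (f x)%:E =
  \int[lebesgue_measure \x lebesgue_rV R d]_p (f (rVcons p))%:E.
Proof.
move=> cf; have := bsupp_integrable cf => intf.
have mf : measurable_fun setT (fun p => f (@rVcons R d p)).
  apply: (@measurableT_comp _ _ _ _ _ _ f).
    by apply: continuous_measurable_rV; case: cf.
  exact: measurable_rVcons.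
have intp : (lebesgue_measure \x lebesgue_rV R d).-integrable setT
    (fun p => (f (rVcons p))%:E).
  apply/integrableP; split; first exact/measurable_EFinP.
  move/integrableP : intf => [mf' ]; rewrite ge0_integral_rVS//.
  exact: measurableT_comp.
split => //.
rewrite -(@integral_pushforward _ _ _ _ R _ (@measurable_rVcons R d)
  (lebesgue_measure \x lebesgue_rV R d) setT (EFin \o f))//.
by apply/measurable_EFinP; apply: continuous_measurable_rV; case: cf.
Qed.

End bsupp.

(** * Derivatives in one variable *)

Section real_functions.
Context {R : realType}.

(** A quadratic Taylor bound valid for all increments gives the derivative even
    at the points where a function defined by cases changes its expression. *)
Lemma is_derive_quadratic (phi : R -> R) (t l K : R) :
  (forall h, `|phi (h + t) - phi t - h * l| <= K * h ^+ 2) ->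
  is_derive t (1 : R) phi l.
Proof.
move=> H.
have K0 : 0 <= K by have := H 1; rewrite expr1n mulr1; apply: le_trans.
have C : h^-1 *: ((phi \o shift t) (h *: (1 : R)) - phi t) @[h --> 0^'] --> l.
  apply/cvgrPdist_le => e e0; near=> h.
  have h0 : h != 0 by near: h; exact: nbhs_dnbhs_neq.
  have hK : `|h| * (K + 1) <= e.
    rewrite -ler_pdivlMr; last by lra.
    near: h; apply: dnbhs0_le; rewrite divr_gt0//; lra.
  rewrite /= /GRing.scale/= mulr1.
  rewrite (_ : _ - _ = - (h^-1 * (phi (h + t) - phi t - h * l))); last by field.
  rewrite normrN normrM normfV ler_pdivrMl ?normr_gt0//.
  rewrite (le_trans (H h))// -real_normK ?num_real// expr2 mulrCA ler_wpM2l//.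
  by rewrite mulrC (le_trans _ hK)// ler_wpM2l//; lra.
apply: DeriveDef; first by apply/cvg_ex; exists l.
by apply/cvg_lim.
Unshelve. all: by end_near. Qed.

Lemma is_derive_continuous (phi psi : R -> R) :
  (forall t, is_derive t (1 : R) phi (psi t)) -> continuous phi.
Proof.
move=> dphi x; apply: differentiable_continuous.
exact/derivable1_diffP/(@ex_derive _ _ _ _ _ _ _ (dphi x)).
Qed.

Lemma continuousZ (c : R) (phi : R -> R) : continuous phi -> continuous (fun t => c * phi t).
Proof.
by move=> cphi x; apply: (@continuousM _ _ (fun=> c)); [exact: cst_continuous|exact: cphi].
Qed.

End real_functions.

(** * Integration by parts *)

Section onedim.
Context {R : realType}.
Implicit Types (phi psi : R -> R) (r s t : R).
Notation mu := (@lebesgue_measure R).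

Lemma FTC2_full phi psi s t : (forall a, is_derive a (1 : R) phi (psi a)) ->
  continuous psi -> s < t ->
  (\int[mu]_(x in `[s, t]) (psi x)%:E = (phi t)%:E - (phi s)%:E)%E.
Proof.
move=> dphi cpsi st.
have cphi : continuous phi by exact: is_derive_continuous dphi.
apply: continuous_FTC2 => //.
- exact: continuous_subspaceT.
- split; first by move=> x _; exact: (@ex_derive _ _ _ _ _ _ _ (dphi x)).
  + by apply: cvg_at_right_filter; exact: cphi.
  + by apply: cvg_at_left_filter; exact: cphi.
- by move=> x _; rewrite derive1E (@derive_val _ _ _ _ _ _ _ (dphi x)).
Qed.

Lemma integral_derive_eq0 phi psi r : (forall a, is_derive a (1 : R) phi (psi a)) ->
  continuous psi -> (forall a, r < `|a| -> phi a = 0) ->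
  (forall a, r < `|a| -> psi a = 0) ->
  (\int[mu]_x (psi x)%:E = 0)%E.
Proof.
move=> dphi cpsi phir psir.
pose s : R := `|r| + 1.
have rs : r < s by rewrite /s; have := ler_norm r; lra.
have s0 : 0 < s by rewrite /s; have := normr_ge0 r; lra.
transitivity (\int[mu]_(x in `[(- s)%R, s]) (psi x)%:E)%E.
  rewrite [RHS]integral_mkcond; apply: eq_integral => x _.
  rewrite patchE; case: ifPn => // /negP; rewrite inE/= in_itv/= -ler_norml => /negP.
  by rewrite -ltNge => sx; rewrite psir// (lt_trans rs).
rewrite (FTC2_full dphi)//; last by lra.
by rewrite !phir ?subee// ?normrN (lt_le_trans rs)// ler_norm.
Qed.

(** phi(a)^2 is the integral of 2 phi phi' up to a.  Bounding this product by
    phi^2 + phi'^2 rather than by the Cauchy-Schwarz inequality keeps the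
    right-hand side additive, so that it can be integrated over further
    variables. *)
Lemma sqr_le_integral phi psi r a : (forall a, is_derive a (1 : R) phi (psi a)) ->
  continuous psi -> (forall a, r < `|a| -> phi a = 0) ->
  ((phi a ^+ 2)%:E <= \int[mu]_x (phi x ^+ 2 + psi x ^+ 2)%:E)%E.
Proof.
move=> dphi cpsi phir.
pose s : R := `|r| + `|a| + 1.
have sa : - s < a.
  by rewrite /s; have := normr_ge0 r; have := ler_normr a (- a); have := lerNnormlW (lexx `|a|); lra.
have cphi : continuous phi by exact: is_derive_continuous dphi.
have d2 x : is_derive x (1 : R) (fun x => phi x ^+ 2) (2 * phi x * psi x).
  have := dphi x => ?.
  rewrite (_ : (fun x => _) = (fun x => phi x) ^+ 2); last by apply/funext => y; rewrite fctE.
  by apply: is_derive_eq; rewrite /GRing.scale/= expr1.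
have c2 : continuous (fun x => 2 * phi x * psi x).
  move=> x; apply: (@continuousM _ _ (fun x => 2 * phi x)) => //; last exact: cpsi.
  by apply: continuousM; [exact: cvg_cst|exact: cphi].
have c3 : continuous (fun x => phi x ^+ 2 + psi x ^+ 2).
  move=> x; apply: (@continuousD _ _ _ (fun x => phi x ^+ 2)).
    by apply: (@continuous_comp _ _ _ phi (fun t => t ^+ 2)); [exact: cphi|exact: exprn_continuous].
  by apply: (@continuous_comp _ _ _ psi (fun t => t ^+ 2)); [exact: cpsi|exact: exprn_continuous].
have -> : ((phi a ^+ 2)%:E = \int[mu]_(x in `[(- s)%R, a]) (2 * phi x * psi x)%:E)%E.
  rewrite (FTC2_full d2)// [phi (- s)]phir ?expr0n ?sube0//.
  rewrite normrN ger0_norm /s; have := normr_ge0 r; have := normr_ge0 a.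
    by have := ler_norm r; lra.
  by lra.
apply: (@le_trans _ _ (\int[mu]_(x in `[(- s)%R, a]) (phi x ^+ 2 + psi x ^+ 2)%:E)%E).
  apply: le_integral => //.
  - apply: continuous_compact_integrable; first exact: segment_compact.
    exact: continuous_subspaceT.
  - apply: continuous_compact_integrable; first exact: segment_compact.
    exact: continuous_subspaceT.
  - move=> x _; rewrite lee_fin -subr_ge0.
    by rewrite (_ : _ - _ = (phi x - psi x) ^+ 2) ?sqr_ge0//; ring.
apply: ge0_subset_integral => //.
- by apply/measurable_EFinP; exact: continuous_measurable_fun.
- by move=> x _; rewrite lee_fin addr_ge0// sqr_ge0.
Qed.

End onedim.

Section ibp.
Context {R : realType}.

(** Induction on the dimension: for the first coordinate the inner integral
    vanishes by the fundamental theorem of calculus; any other coordinate is a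
    coordinate of the slices. *)
Lemma integral_partial_eq0 d (i : 'I_d) (u : 'rV[R]_d -> R) : bsupp u ->
  (forall x, derivable u x (delta_mx ord0 i)) -> continuous (partial i u) ->
  (\int[lebesgue_rV R d]_x (partial i u x)%:E = 0)%E.
Proof.
elim: d i u => [[]//|d IH i u ccu du cu].
have ccp := bsupp_partial ccu cu.
have [ip ->] := integral_rVS ccp.
case: (unliftP ord0 i) du cu ccp ip => [j ->|->] du cu ccp ip.
  rewrite -integral12_prod_meas1//= integral0_eq// => a _; rewrite /fubini_F.
  under eq_integral => y _ do rewrite -(derive_sliceS (du _)).2.
  apply: IH.
  - exact: bsupp_slicer.
  - by move=> x; exact: (derive_sliceS (du _)).1.
  - rewrite (_ : partial _ _ = fun y => partial (lift ord0 j) u (rVcons (a, y))).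
      by case: (bsupp_slicer a ccp).
    by apply/funext => y; exact: (derive_sliceS (du _)).2.
rewrite -integral21_prod_meas1//= integral0_eq// => y _; rewrite /fubini_G.
have [_ [r ur]] := ccu.
apply: (@integral_derive_eq0 _ (fun a => u (rVcons (a, y))) _ r).
- by move=> a; exact: derive_slice0.
- by case: (bsupp_slicel y ccp).
- by move=> a ra; apply: ur; exists ord0; rewrite rVcons0E.
- by move=> a ra; apply: (partial_eq0 _ ur); exists ord0; rewrite rVcons0E.
Qed.

End ibp.

(** * A logarithmic Sobolev inequality for Lebesgue measure *)

Definition C1 {R : realType} {d} (f : 'rV[R]_d -> R) : Prop :=
  continuous f /\ forall i : 'I_d, (forall x, derivable f x (delta_mx ord0 i)) /\
                       continuous (partial i f).

Section slice_bounds.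
Context {R : realType}.

(** Since ln(1 + x + y) = ln(1 + x) + ln(1 + y / (1 + x)), adding y inside the
    logarithm costs at most y, without any constant.  This is what lets the
    energies of the different coordinates add up in the induction below. *)
Lemma ln1D_sub (x y : R) : 0 <= x -> 0 <= y ->
  x * ln (1 + x + y) <= x * ln (1 + x) + y.
Proof.
move=> x0 y0; have x1 : 0 < 1 + x by lra.
have -> : 1 + x + y = (1 + x) * (1 + y / (1 + x)) by field; rewrite gt_eqF.
have y1 : 0 <= y / (1 + x) by rewrite divr_ge0// ltW.
rewrite lnM ?posrE//; last by lra.
rewrite mulrDr lerD2l (le_trans (ler_wpM2l x0 (le_ln1Dx _)))//; first by lra.
by rewrite mulrCA ler_piMr// ler_pdivrMr// mul1r; lra.
Qed.

Lemma bsupp_mul d (f g : 'rV[R]_d -> R) : continuous f -> bsupp g -> bsupp (fun x => f x * g x).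
Proof.
move=> cf [cg [r gr]]; split; last by exists r => x xr; rewrite gr// mulr0.
by move=> x; apply: continuousM; [exact: cf|exact: cg].
Qed.

Lemma bsupp_sqr d (f : 'rV[R]_d -> R) : bsupp f -> bsupp (fun x => f x ^+ 2).
Proof.
by move=> ccf; have := bsupp_mul ccf.1 ccf; under eq_fun do rewrite -expr2.
Qed.

Lemma continuous_measurable_EFin d (f : 'rV[R]_d -> R) : continuous f ->
  measurable_fun setT (EFin \o f).
Proof. by move=> cf; apply/measurable_EFinP; exact: continuous_measurable_rV. Qed.

Lemma continuous_sqr d (f : 'rV[R]_d -> R) : continuous f ->
  continuous (fun x => f x ^+ 2).
Proof.
by move=> cf x; apply: (@continuous_comp _ _ _ f (fun t => t ^+ 2)); [exact: cf|exact: exprn_continuous].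
Qed.

Lemma continuous_bigsum d I (s : seq I) (f : I -> 'rV[R]_d -> R) :
  (forall i, continuous (f i)) ->
  continuous (fun x => \sum_(i <- s) f i x).
Proof.
move=> cf; elim: s => [|i s IH] x.
  by under eq_fun do rewrite big_nil; exact: cst_continuous.
under eq_fun do rewrite big_cons; apply: (@continuousD _ _ _ (f i)); [exact: cf|exact: IH].
Qed.

Local Open Scope ereal_scope.

(** The mass of every slice is bounded by the total mass plus the energy in the
    transverse direction: apply sqr_le_integral on each transverse line and
    integrate. *)
Lemma slice_integral_le d (g : 'rV[R]_d.+1 -> R) (a : R) : bsupp g ->
  (forall x, derivable g x (delta_mx ord0 ord0)) -> continuous (partial ord0 g) ->
  \int[lebesgue_rV R d]_y (g (rVcons (a, y)) ^+ 2)%:E <=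
  \int[lebesgue_rV R d.+1]_x (g x ^+ 2)%:E +
  \int[lebesgue_rV R d.+1]_x (partial ord0 g x ^+ 2)%:E.
Proof.
move=> ccg dg cg; have [cgg [r gr]] := ccg.
have m2 : measurable_fun setT (fun x => (g x ^+ 2 + partial ord0 g x ^+ 2)%:E).
  apply: continuous_measurable_EFin => x; apply: (@continuousD _ _ _ (fun x => g x ^+ 2)%R).
    exact: continuous_sqr.
  exact: continuous_sqr.
have m3 : measurable_fun setT (fun p => (g (@rVcons R d p) ^+ 2 + partial ord0 g (rVcons p) ^+ 2)%:E).
  by apply: (measurableT_comp m2); exact: measurable_rVcons.
rewrite -ge0_integralD//; first last.
- by apply: continuous_measurable_EFin; exact: continuous_sqr.
- by move=> x _; rewrite lee_fin sqr_ge0.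
- by apply: continuous_measurable_EFin; exact: continuous_sqr.
- by move=> x _; rewrite lee_fin sqr_ge0.
under [leRHS]eq_integral do rewrite -EFinD.
rewrite ge0_integral_rVS//; last by move=> x; rewrite lee_fin addr_ge0 ?sqr_ge0.
rewrite fubini_tonelli2//; last by move=> x; rewrite lee_fin addr_ge0 ?sqr_ge0.
apply: ge0_le_integral => //.
- by move=> y _; rewrite lee_fin sqr_ge0.
- by apply: continuous_measurable_EFin; case: (bsupp_sqr (bsupp_slicer a ccg)).
- by apply: measurable_fun_fubini_tonelli_G => // p; rewrite lee_fin addr_ge0 ?sqr_ge0.
move=> y _; rewrite /fubini_G.
apply: (@sqr_le_integral _ (fun a => g (rVcons (a, y))) (fun a => partial ord0 g (rVcons (a, y))) r).
- by move=> b; exact: derive_slice0.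
- by move=> b; apply: continuous_comp; [exact: rVcons_continuousl|exact: cg].
- by move=> b br; apply: gr; exists ord0; rewrite rVcons0E.
Qed.

End slice_bounds.

Section euclidean_lsi.
Context {R : realType}.

Definition gradsq d (f : 'rV[R]_d -> R) (x : 'rV[R]_d) : R :=
  \sum_(i < d) partial i f x ^+ 2.

Lemma gradsq_ge0 d (f : 'rV[R]_d -> R) x : 0 <= gradsq f x.
Proof. by apply: sumr_ge0 => i _; exact: sqr_ge0. Qed.

Lemma C1_slice d (f : 'rV[R]_d.+1 -> R) a : C1 f -> C1 (fun y => f (rVcons (a, y))).
Proof.
move=> [cf df]; split.
  by move=> y; apply: continuous_comp; [exact: rVcons_continuousr|exact: cf].
move=> i; have [di ci] := df (lift ord0 i).
split; first by move=> x; exact: (derive_sliceS (di _)).1.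
rewrite (_ : partial _ _ = fun y => partial (lift ord0 i) f (rVcons (a, y))).
  by move=> y; apply: continuous_comp; [exact: rVcons_continuousr|exact: ci].
by apply/funext => y; exact: (derive_sliceS (di _)).2.
Qed.

Lemma continuous_gradsq d (f : 'rV[R]_d -> R) : C1 f -> continuous (gradsq f).
Proof.
move=> [_ df]; apply: continuous_bigsum => i.
by apply: continuous_sqr; case: (df i).
Qed.

Lemma bsupp_fin_num d (f : 'rV[R]_d -> R) : bsupp f ->
  (\int[lebesgue_rV R d]_x (f x)%:E)%E \is a fin_num.
Proof. by move=> ccf; apply: integrable_fin_num => //; exact: bsupp_integrable. Qed.

(** The use of ln(1 + g^2) instead of ln(g^2) makes all integrands nonnegative, so
    that no integrability at infinity is needed.  Induction on the dimension:
    on the slice at a, of mass G(a), the induction hypothesis bounds the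
    integral by G(a) ln(1 + G(a)) plus the energy along the slice.  By
    slice_integral_le, G(a) <= N + D0 where D0 is the transverse energy, hence
    the integral of G ln(1 + G) is at most N ln(1 + N + D0), and ln1D_sub turns
    this into N ln(1 + N) + D0. *)
Lemma euclidean_lsi d (g : 'rV[R]_d -> R) (N : R) : C1 g -> bsupp g ->
  (N%:E = \int[lebesgue_rV R d]_x (g x ^+ 2)%:E)%E ->
  (\int[lebesgue_rV R d]_x (g x ^+ 2 * ln (1 + g x ^+ 2))%:E <=
   (N * ln (1 + N))%:E + \int[lebesgue_rV R d]_x (gradsq g x)%:E)%E.
Proof.
have plnp_ge0 (p : R) : 0 <= p -> 0 <= p * ln (1 + p).
  by move=> p0; rewrite mulr_ge0// ln_ge0// lerDl.
elim: d g N => [|d IH] g N C1g ccg.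
  rewrite /= !integral_dirac//=; last 3 first.
  - apply/measurable_EFinP; apply: continuous_measurable_rV; apply: continuous_gradsq C1g.
  - apply/measurable_EFinP; apply: measurable_funM.
      by apply: continuous_measurable_rV; apply: continuous_sqr; case: ccg.
    apply: measurableT_comp => //; apply: measurable_funD => //.
    by apply: continuous_measurable_rV; apply: continuous_sqr; case: ccg.
  - by apply: continuous_measurable_EFin; apply: continuous_sqr; case: ccg.
  by rewrite !diracT !mul1e => -[->]; rewrite leeDl// lee_fin gradsq_ge0.
move=> NE; have [cg dg] := C1g; have [dg0 cg0] := dg ord0.
pose L := @lebesgue_measure R; pose M := lebesgue_rV R d.
pose G (a : measurableTypeR R) : R := fine (\int[M]_y (g (rVcons (a, y)) ^+ 2)%:E)%E.
pose D0 := fine (\int[lebesgue_rV R d.+1]_x (partial ord0 g x ^+ 2)%:E)%E.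
pose H (x : 'rV[R]_d.+1) : R := \sum_(i < d) partial (lift ord0 i) g x ^+ 2.
have H0 x : 0 <= H x by apply: sumr_ge0 => i _; exact: sqr_ge0.
have cH : continuous H.
  by apply: continuous_bigsum => i; apply: continuous_sqr; case: (dg (lift ord0 i)).
have cg2 : continuous (fun x => g x ^+ 2) by exact: continuous_sqr.
have mp : measurable_fun setT (fun x => g x ^+ 2 * ln (1 + g x ^+ 2)).
  apply: measurable_funM; first exact: continuous_measurable_rV.
  by apply: measurableT_comp => //; apply: measurable_funD => //; exact: continuous_measurable_rV.
have mcomp (F : 'rV[R]_d.+1 -> R) : measurable_fun setT F ->
    measurable_fun setT (fun p => (F (@rVcons R d p))%:E).
  move=> mF; apply/measurable_EFinP.
  by apply: (measurableT_comp mF); exact: measurable_rVcons.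
have GE a : ((G a)%:E = \int[M]_y (g (rVcons (a, y)) ^+ 2)%:E)%E.
  by rewrite fineK//; apply: bsupp_fin_num; apply: bsupp_sqr; exact: bsupp_slicer.
have G0 a : 0 <= G a.
  by rewrite -lee_fin GE; apply: integral_ge0 => y _; rewrite lee_fin sqr_ge0.
have mGE : measurable_fun setT (EFin \o G).
  rewrite (_ : EFin \o G = fubini_F M (fun p => (g (@rVcons R d p) ^+ 2)%:E)).
    apply: measurable_fun_fubini_tonelli_F; last by move=> p; rewrite lee_fin sqr_ge0.
    by apply: (mcomp (fun x => g x ^+ 2)); exact: continuous_measurable_rV.
  by apply/funext => a; rewrite /= GE.
have mG : measurable_fun setT G by exact/measurable_EFinP.
have D0E : (D0%:E = \int[lebesgue_rV R d.+1]_x (partial ord0 g x ^+ 2)%:E)%E.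
  by rewrite fineK//; apply: bsupp_fin_num; apply: bsupp_sqr; exact: bsupp_partial.
have N0 : 0 <= N by rewrite -lee_fin NE integral_ge0// => x _; rewrite lee_fin sqr_ge0.
have D00 : 0 <= D0 by rewrite -lee_fin D0E integral_ge0// => x _; rewrite lee_fin sqr_ge0.
have Gle a : G a <= N + D0.
  by rewrite -lee_fin GE EFinD NE D0E; exact: slice_integral_le.
have intG : (\int[L]_a (G a)%:E = N%:E)%E.
  under eq_integral do rewrite GE.
  rewrite NE ge0_integral_rVS//; last 2 first.
  - exact: continuous_measurable_EFin.
  - by move=> x; rewrite lee_fin sqr_ge0.
  rewrite (fubini_tonelli1 (fun p => (g (@rVcons R d p) ^+ 2)%:E)%E)//.
    by apply: (mcomp (fun x => g x ^+ 2)); exact: continuous_measurable_rV.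
  by move=> p; rewrite lee_fin sqr_ge0.
have mGl : measurable_fun setT (fun a => G a * ln (1 + G a)).
  apply: measurable_funM => //.
  by apply: measurableT_comp => //; apply: measurable_funD.
have mFH : measurable_fun setT (fun a : measurableTypeR R => \int[M]_y (H (rVcons (a, y)))%:E)%E.
  apply: (measurable_fun_fubini_tonelli_F (fun p => (H (@rVcons R d p))%:E)).
    by apply: mcomp; exact: continuous_measurable_rV.
  by move=> p; rewrite lee_fin.
apply: (@le_trans _ _ (\int[L]_a ((G a * ln (1 + G a))%:E + \int[M]_y (H (rVcons (a, y)))%:E))%E).
  rewrite ge0_integral_rVS//; last 2 first.
  - exact/measurable_EFinP.
  - by move=> x; rewrite lee_fin plnp_ge0// sqr_ge0.
  rewrite (fubini_tonelli1 (fun p => (g (@rVcons R d p) ^+ 2 * ln (1 + g (@rVcons R d p) ^+ 2))%:E)%E)//; last 2 first.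
  - exact: (mcomp (fun x => g x ^+ 2 * ln (1 + g x ^+ 2))).
  - by move=> x; rewrite lee_fin plnp_ge0// sqr_ge0.
  apply: ge0_le_integral => //.
  - move=> a _; apply: integral_ge0 => y _.
    by rewrite lee_fin plnp_ge0// sqr_ge0.
  - apply: measurable_fun_fubini_tonelli_F.
      exact: (mcomp (fun x => g x ^+ 2 * ln (1 + g x ^+ 2))).
    by move=> x; rewrite lee_fin plnp_ge0// sqr_ge0.
  - by apply: emeasurable_funD => //; exact/measurable_EFinP.
  - move=> a _; rewrite /fubini_F.
    have := IH _ _ (C1_slice a C1g) (bsupp_slicer a ccg) (GE a).
    rewrite /gradsq.
    under [X in (_ <= _ + X)%E -> _]eq_integral => y _ do
      under eq_bigr => i _ do rewrite (derive_sliceS ((dg (lift ord0 i)).1 _)).2.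
    by [].
rewrite ge0_integralD//; last 3 first.
- by move=> a _; rewrite lee_fin plnp_ge0.
- exact/measurable_EFinP.
- by move=> a _; apply: integral_ge0 => y _; rewrite lee_fin.
have -> : (\int[L]_a \int[M]_y (H (rVcons (a, y)))%:E = \int[lebesgue_rV R d.+1]_x (H x)%:E)%E.
  rewrite ge0_integral_rVS//; last exact: continuous_measurable_EFin.
  rewrite (fubini_tonelli1 (fun p => (H (@rVcons R d p))%:E)%E)//.
    by apply: mcomp; exact: continuous_measurable_rV.
  by move=> p; rewrite lee_fin.
have -> : (\int[lebesgue_rV R d.+1]_x (gradsq g x)%:E = D0%:E + \int[lebesgue_rV R d.+1]_x (H x)%:E)%E.
  rewrite D0E -ge0_integralD//.
  - by apply: eq_integral => x _; rewrite -EFinD /gradsq big_ord_recl.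
  - by move=> x _; rewrite lee_fin sqr_ge0.
  - by apply: continuous_measurable_EFin; exact: continuous_sqr.
  - by move=> x _; rewrite lee_fin.
  - exact: continuous_measurable_EFin.
rewrite [leRHS]addeA; apply: leeD2r; rewrite -EFinD.
apply: (@le_trans _ _ (\int[L]_a (ln (1 + N + D0) * G a)%:E)%E).
  apply: ge0_le_integral => //.
  - by move=> a _; rewrite lee_fin plnp_ge0.
  - exact/measurable_EFinP.
  - by apply/measurable_EFinP; apply: measurable_funM.
  - move=> a _; rewrite lee_fin mulrC ler_wpM2r// ler_ln ?posrE; have := Gle a; have := G0 a; lra.
under eq_integral do rewrite EFinM.
have ln0 : 0 <= ln (1 + N + D0) by rewrite ln_ge0//; lra.
rewrite ge0_integralZl_EFin//; last by move=> a _; rewrite lee_fin.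
apply: (@le_trans _ _ ((ln (1 + N + D0))%:E * N%:E)%E); first by rewrite -intG.
by rewrite -EFinM lee_fin mulrC; exact: ln1D_sub.
Qed.

End euclidean_lsi.

(** * Integrals of nonnegative functions *)

Section density.
Local Open Scope ereal_scope.
Context dd (T : measurableType dd) (R : realType).
Variables (m mu : {measure set T -> \bar R}) (h : T -> R).
Hypothesis (mh : measurable_fun setT h) (h0 : forall x, (0 <= h x)%R).
Hypothesis muE : forall A, measurable A -> mu A = \int[m]_(x in A) (h x)%:E.
Import HBNNSimple.

(** True by hypothesis for indicators, hence for simple functions, hence for
    their increasing limits. *)
Lemma ge0_integral_density (f : T -> \bar R) : measurable_fun setT f ->
  (forall x, 0 <= f x) -> \int[mu]_x f x = \int[m]_x (f x * (h x)%:E).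
Proof.
move=> mf f0.
have mhE : measurable_fun setT (EFin \o h) by exact/measurable_EFinP.
have sfE (g : {nnsfun T >-> R}) :
    \int[mu]_x (g x)%:E = \int[m]_x ((g x)%:E * (h x)%:E).
  under eq_integral do rewrite fimfunE -fsumEFin//.
  rewrite ge0_integral_fsum//; last 2 first.
    by move=> r; exact/measurable_EFinP/measurableT_comp.
    by move=> n x _; rewrite EFinM nnfun_muleindic_ge0.
  under [RHS]eq_integral.
    move=> x _; rewrite fimfunE -fsumEFin// muleC ge0_mule_fsumr; last first.
      by move=> r; rewrite EFinM nnfun_muleindic_ge0.
    over.
  rewrite ge0_integral_fsum//; last 2 first.
    move=> r; apply: emeasurable_funM => //.
    by apply/measurable_EFinP/measurableT_comp.
    move=> n x _; rewrite mule_ge0 ?lee_fin// -lee_fin EFinM.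
    by rewrite nnfun_muleindic_ge0.
  apply: eq_fsbigr => r _.
  rewrite integralZl_indic_nnsfun// integral_indic// setIT muE//.
  have [r0|r0] := ltP r 0%R.
    rewrite preimage_nnfun0// integral_set0 mule0.
    by rewrite integral0_eq// => x _; rewrite indic0 mulr0 mule0.
  rewrite integral_mkcond -ge0_integralZl_EFin//; last 2 first.
    by move=> x _; rewrite patchE; case: ifPn; rewrite // lee_fin.
    by apply/(measurable_restrictT _ _).1 => //; exact: measurable_funTS.
  apply: eq_integral => x _; rewrite patchE indicE; case: ifPn => xr.
    by rewrite mulr1 muleC.
  by rewrite mulr0 !mule0.
pose f_ := nnsfun_approx measurableT mf.
transitivity (limn (fun n => \int[mu]_x (f_ n x)%:E)).
  rewrite -monotone_convergence//=.
  - apply: eq_integral => ? /[!inE] xD; apply/esym/cvg_lim => //=.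
    exact: cvg_nnsfun_approx.
  - by move=> n; exact/measurable_EFinP/measurable_funTS.
  - by move=> n ? _; rewrite lee_fin.
  - by move=> ? _ ? ? mn; rewrite lee_fin; exact/lefP/nd_nnsfun_approx.
under eq_fun do rewrite sfE.
rewrite -monotone_convergence//=.
- apply: eq_integral => x _; apply/cvg_lim => //=.
  apply: cvgeZr => //.
  exact: cvg_nnsfun_approx.
- by move=> n; apply: emeasurable_funM => //; exact/measurable_EFinP.
- by move=> n ? _; rewrite mule_ge0 ?lee_fin.
- move=> x _ ? ? mn; rewrite lee_wpmul2r ?lee_fin//.
  exact/lefP/nd_nnsfun_approx.
Qed.
End density.

Section real_integrands.
Context dd (T : measurableType dd) (R : realType) (mu : {measure set T -> \bar R}).
Implicit Types f g : T -> R.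

Lemma ge0_integral_EFin f : (forall x, 0 <= f x) -> (0 <= \int[mu]_x (f x)%:E)%E.
Proof. by move=> f0; apply: integral_ge0 => x _; rewrite lee_fin. Qed.

Lemma le_integral_EFin f g : measurable_fun setT f -> measurable_fun setT g ->
  (forall x, 0 <= f x) -> (forall x, f x <= g x) -> (\int[mu]_x (f x)%:E <= \int[mu]_x (g x)%:E)%E.
Proof.
move=> mf mg f0 fg; apply: ge0_le_integral => //.
- by move=> x _; rewrite lee_fin.
- exact/measurable_EFinP.
- exact/measurable_EFinP.
- by move=> x _; rewrite lee_fin.
Qed.

Lemma integral_EFinD f g : measurable_fun setT f -> measurable_fun setT g ->
  (forall x, 0 <= f x) -> (forall x, 0 <= g x) -> 
  (\int[mu]_x (f x + g x)%:E = \int[mu]_x (f x)%:E + \int[mu]_x (g x)%:E)%E.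
Proof.
move=> mf mg f0 g0; rewrite -ge0_integralD//.
- by move=> x _; rewrite lee_fin.
- exact/measurable_EFinP.
- by move=> x _; rewrite lee_fin.
- exact/measurable_EFinP.
Qed.

Lemma integral_EFinZ k f : measurable_fun setT f -> 0 <= k ->
  (forall x, 0 <= f x) -> 
  (\int[mu]_x (k * f x)%:E = k%:E * \int[mu]_x (f x)%:E)%E.
Proof.
move=> mf k0 f0; rewrite -ge0_integralZl_EFin//.
- by move=> x _; rewrite lee_fin.
- exact/measurable_EFinP.
Qed.

(** Here f may change sign and need not be integrable: its integral is at most
    that of its positive part. *)
Lemma le_integral_ge0 f g :
  measurable_fun setT f -> measurable_fun setT g -> (forall x, 0 <= g x) ->
  (forall x, f x <= g x) -> (\int[mu]_x (f x)%:E <= \int[mu]_x (g x)%:E)%E.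
Proof.
move=> mf mg g0 fg; rewrite [leLHS]integralE.
apply: (@le_trans _ _ (\int[mu]_x ((EFin \o f)^\+ x))%E).
  by rewrite -[leRHS]sube0; apply: leeB => //; exact: integral_ge0.
apply: ge0_le_integral => //.
- by apply: measurable_funepos; exact/measurable_EFinP.
- exact/measurable_EFinP.
- by move=> x _; rewrite funeposE /= -EFin_max lee_fin ge_max fg g0.
Qed.

End real_integrands.

(** * Functions of class C^1 *)

Section calculus.
Context {R : realType} {d : nat}.
Implicit Types (u v f : 'rV[R]_d -> R) (phi psi : R -> R).

Lemma is_derive_partial u x (i : 'I_d) : derivable u x (delta_mx ord0 i) ->
  is_derive x (delta_mx ord0 i) u (partial i u x).
Proof. by move=> du; apply: DeriveDef. Qed.

Lemma is_derive_comp_line (U : normedModType R) (u : U -> R) (x v : U) (phi : R -> R) (a b : R) :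
  is_derive (u x) (1 : R) phi a -> is_derive x v u b ->
  is_derive x v (phi \o u) (a * b).
Proof.
move=> dphi [du <-].
have [l1 l2] := @derive_line R _ _ u (fun t : R => u (t *: v + x)) x v 0 1
  (fun h => congr1 (fun t => u (t *: v + x)) (esym (etrans (addr0 _) (mulr1 h)))).
have [l3 l4] := @derive_line R _ _ (phi \o u) (phi \o (fun t : R => u (t *: v + x))) x v 0 1
  (fun h => congr1 (fun t => phi (u (t *: v + x))) (esym (etrans (addr0 _) (mulr1 h)))).
have dg : is_derive (0 : R) (1 : R) (fun t : R => u (t *: v + x)) ('D_v u x).
  by apply: DeriveDef; [exact: l1.1|rewrite l2].
have dphi' : is_derive (u (0 *: v + x)) (1 : R) phi a by rewrite scale0r add0r.
have [D1 D2] := is_derive1_comp dphi' dg.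
by apply: DeriveDef; [exact: l3.2|rewrite l4].
Qed.

Lemma C1_comp u phi psi : C1 u -> (forall t, is_derive t (1 : R) phi (psi t)) ->
  continuous psi -> C1 (phi \o u) /\
  forall i x, partial i (phi \o u) x = psi (u x) * partial i u x.
Proof.
move=> [cu du] dphi cpsi.
have cphi : continuous phi by exact: is_derive_continuous dphi.
have D i x : is_derive x (delta_mx ord0 i) (phi \o u) (psi (u x) * partial i u x).
  by apply: is_derive_comp_line => //; apply: is_derive_partial; exact: (du i).1.
have E i x : partial i (phi \o u) x = psi (u x) * partial i u x.
  exact: (@derive_val _ _ _ _ _ _ _ (D i x)).
split => //; split.
  by move=> x; apply: continuous_comp; [exact: cu|exact: cphi].
move=> i; split; first by move=> x; exact: (@ex_derive _ _ _ _ _ _ _ (D i x)).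
rewrite (_ : partial _ _ = fun x => psi (u x) * partial i u x); last exact/funext.
move=> x; apply: (@continuousM _ _ (fun x => psi (u x))); last exact: (du i).2.
by apply: continuous_comp; [exact: cu|exact: cpsi].
Qed.

Lemma C1_mul u v : C1 u -> C1 v -> C1 (fun x => u x * v x) /\
  forall i x, partial i (fun x => u x * v x) x =
              u x * partial i v x + v x * partial i u x.
Proof.
move=> [cu du] [cv dv].
have D i x : is_derive x (delta_mx ord0 i) (fun x => u x * v x)
    (u x * partial i v x + v x * partial i u x).
  have := is_derive_partial ((du i).1 x) => ?.
  have := is_derive_partial ((dv i).1 x) => ?.
  exact: is_deriveM.
have E i x : partial i (fun x => u x * v x) x = u x * partial i v x + v x * partial i u x.
  exact: (@derive_val _ _ _ _ _ _ _ (D i x)).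
split => //; split; first by move=> x; apply: continuousM; [exact: cu|exact: cv].
move=> i; split; first by move=> x; exact: (@ex_derive _ _ _ _ _ _ _ (D i x)).
rewrite (_ : partial _ _ = fun x => u x * partial i v x + v x * partial i u x); last exact/funext.
move=> x; apply: (@continuousD _ _ _ (fun x => u x * partial i v x)).
  by apply: continuousM; [exact: cu|exact: (dv i).2].
by apply: (@continuousM _ _ v); [exact: cv|exact: (du i).2].
Qed.

Lemma gradsqE f x : enorm (gradient f x) ^+ 2 = gradsq f x.
Proof.
rewrite sqr_sqrtr; last by apply: sumr_ge0 => i _; exact: sqr_ge0.
by apply: eq_bigr => i _; rewrite mxE.
Qed.

Lemma class_C1 f k : class_C k.+1 f -> C1 f.
Proof.
move=> [cf df]; split => // i; have [di ci] := df i; split => //.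
by case: k ci {df} => [|k] [].
Qed.

Lemma C1_measurable (f : 'rV[R]_d -> R) : C1 f -> measurable_fun setT f.
Proof. by move=> [cf _]; exact: continuous_measurable_rV. Qed.

Lemma C1_measurable_gradsq (f : 'rV[R]_d -> R) : C1 f -> measurable_fun setT (gradsq f).
Proof. by move=> C1f; apply: continuous_measurable_rV; exact: continuous_gradsq. Qed.

End calculus.

(** * Energy estimate from the drift condition *)

Definition drift_weight {R : realType} {d} (V : 'rV[R]_d -> R) (tau : R) (x : 'rV[R]_d) : R :=
  Num.max (V x) 1 `^ tau.

Section drift.
Context {R : realType} {d : nat}.
Variables (V : 'rV[R]_d -> R) (s t C tau : R).
Hypothesis V2 : class_C 2 V.
Hypotheses (s0 : 0 < s) (t01 : 0 < t < 1).
Hypothesis drift : forall x,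
    s * Num.max (V x) 1 `^ tau <=
    (1 - t) * enorm (gradient V x) ^+ 2 - laplacian V x + C.
Let lam := lebesgue_rV R d.
Local Notation M := (drift_weight V tau).

Let C1V : C1 V. Proof. exact: class_C1 V2. Qed.

Lemma measurable_drift_weight : measurable_fun setT M.
Proof.
have [cV _] := C1V.
apply: (measurableT_comp (measurable_powR tau)).
by apply: measurable_maxr => //; exact: continuous_measurable_rV.
Qed.

Lemma bsupp_energy (a b : R) (u : 'rV[R]_d -> R) : C1 u -> bsupp u ->
  bsupp (fun x => (a * u x ^+ 2 + b * gradsq u x) * expR (- V x)).
Proof.
move=> C1u [cu [r ur]]; split.
  move=> x; apply: (@continuousM _ _ (fun x => a * u x ^+ 2 + b * gradsq u x)).
    apply: (@continuousD _ _ _ (fun x => a * u x ^+ 2)).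
      by apply: (@continuousM _ _ (fun=> a)); [exact: cst_continuous|exact: continuous_sqr].
    by apply: (@continuousM _ _ (fun=> b)); [exact: cst_continuous|exact: continuous_gradsq].
  apply: (@continuous_comp _ _ _ (fun x => - V x) expR); last exact: continuous_expR.
  by apply: continuousN; case: C1V => cV _; exact: cV.
exists r => x xr; rewrite ur// expr0n mulr0 add0r /gradsq big1 ?mulr0 ?mul0r//.
by move=> i _; rewrite (partial_eq0 i ur)// expr0n.
Qed.

(** The divergence of the field u^2 e^(-V) grad V is
    e^(-V) (2 u grad u . grad V - u^2 |grad V|^2 + u^2 Delta V) and has integral
    zero.  The drift condition bounds u^2 (s M + (t/2) |grad V|^2) by
    u^2 (|grad V|^2 - Delta V + |C|) - (t/2) u^2 |grad V|^2, and the last term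
    pays for the cross term through
    2 u grad u . grad V <= (t/2) u^2 |grad V|^2 + (2/t) |grad u|^2. *)
Lemma drift_lebesgue (u : 'rV[R]_d -> R) : C1 u -> bsupp u ->
  (\int[lam]_x (u x ^+ 2 * (s * M x + t / 2 * gradsq V x) * expR (- V x))%:E <=
   \int[lam]_x ((`|C| * u x ^+ 2 + 2 / t * gradsq u x) * expR (- V x))%:E)%E.
Proof.
move=> C1u ccu.
have [cV dV] := C1V; have [cu du] := C1u.
have [C1E EE] : C1 (fun x => expR (- V x)) /\
    forall i x, partial i (fun x => expR (- V x)) x = - expR (- V x) * partial i V x.
  apply: (@C1_comp _ _ V (fun t => expR (- t)) (fun t => - expR (- t))) => //.
  - move=> a; apply: is_derive_eq; rewrite /GRing.scale/=; ring.
  - move=> a; apply: cvgN; apply: (@continuous_comp _ _ _ -%R expR).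
      exact: opp_continuous.
    exact: continuous_expR.
have C1V' i : C1 (partial i V) by exact: (@class_C1 _ _ _ 0 (V2.2 i).2).
have [C1u2 u2E] := C1_mul C1u C1u.
have [C1uE uEE] := C1_mul C1u2 C1E.
pose W i x := (u x * u x * expR (- V x)) * partial i V x.
have CW i := C1_mul C1uE (C1V' i).
have ccW i : bsupp (W i).
  have [_ [r ur]] := ccu.
  by split; [case: (CW i).1|exists r => x xr; rewrite /W ur// !mul0r].
have ccdW i : bsupp (partial i (W i)).
  by apply: bsupp_partial => //; exact: ((CW i).1.2 i).2.
pose D x := \sum_(i < d) partial i (W i) x.
have iD : (\int[lam]_x (D x)%:E = 0)%E.
  under eq_integral do rewrite -sumEFin.
  rewrite integral_sum//; last by move=> i; exact: bsupp_integrable.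
  rewrite big1// => i _; apply: integral_partial_eq0 => //.
  - exact: ((CW i).1.2 i).1.
  - exact: ((CW i).1.2 i).2.
have DE x : D x = expR (- V x) * (2 * u x * (\sum_(i < d) partial i u x * partial i V x)
    - u x ^+ 2 * gradsq V x + u x ^+ 2 * laplacian V x).
  rewrite /D /gradsq /laplacian !mulr_sumr -sumrB -big_split/= mulr_sumr.
  apply: eq_bigr => i _; rewrite (CW i).2 uEE u2E EE; ring.
pose B x := (`|C| * u x ^+ 2 + 2 / t * gradsq u x) * expR (- V x).
have t0 : 0 < t by case/andP: t01.
have ccB : bsupp B by exact: bsupp_energy.
have iB : lam.-integrable setT (EFin \o B) by exact: bsupp_integrable.
have iD' : lam.-integrable setT (EFin \o D).
  rewrite (_ : EFin \o D = fun x => (\sum_(i < d) (partial i (W i) x)%:E)%E); last first.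
    by apply/funext => x; rewrite /= sumEFin.
  by apply: integrable_sum => // i _; exact: bsupp_integrable.
have le x : u x ^+ 2 * (s * M x + t / 2 * gradsq V x) * expR (- V x) <= B x - D x.
  rewrite DE /B [X in _ <= _ - X]mulrC -mulrBl ler_pM2r ?expR_gt0//.
  have := drift x; rewrite -/(M x) gradsqE => dr.
  have : 2 * u x * (\sum_(i < d) partial i u x * partial i V x) <= t / 2 * u x ^+ 2 * gradsq V x + 2 / t * gradsq u x.
    rewrite /gradsq !mulr_sumr -big_split/= ler_sum// => i _.
    rewrite -subr_ge0.
    rewrite (_ : _ - _ = (2 * t)^-1 * (t * u x * partial i V x - 2 * partial i u x) ^+ 2); last first.
      by field; rewrite gt_eqF.
    by rewrite mulr_ge0 ?sqr_ge0// invr_ge0 mulr_ge0// ltW.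
  move=> cs.
  have : u x ^+ 2 * (s * M x) <= u x ^+ 2 * ((1 - t) * gradsq V x - laplacian V x + `|C|).
    by rewrite ler_wpM2l ?sqr_ge0// (le_trans dr)// lerD2l ler_norm.
  move: cs; set q := \sum_(i < d) _; lra.
apply: (@le_trans _ _ (\int[lam]_x ((B x)%:E - (D x)%:E))%E).
  apply: ge0_le_integral => //.
  - move=> x _; rewrite lee_fin; apply: mulr_ge0; last exact: expR_ge0.
    apply: mulr_ge0; first exact: sqr_ge0.
    apply: addr_ge0; apply: mulr_ge0; rewrite ?gradsq_ge0 ?powR_ge0 ?divr_ge0// ltW//.
  - apply/measurable_EFinP; apply: measurable_funM; last by apply: continuous_measurable_rV; case: C1E.
    apply: measurable_funM; first by apply: continuous_measurable_rV; exact: continuous_sqr.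
    apply: measurable_funD; apply: measurable_funM => //; first exact: measurable_drift_weight.
    by apply: continuous_measurable_rV; exact: continuous_gradsq.
  - by apply: emeasurable_funB; [exact: measurable_int iB|exact: measurable_int iD'].
  - by move=> x _; rewrite -EFinB lee_fin.
by rewrite integralB_EFin// iD sube0.
Qed.

End drift.

(** * Cutoff and truncation *)

Section cutoff.
Context {R : realType}.

(** A C^1 function that vanishes on the negative half-line, used to build a
    cutoff of class C^1. *)
Definition sqr_pos (t : R) : R := Num.max 0 t ^+ 2.

Lemma is_derive_sqr_pos t : is_derive t (1 : R) sqr_pos (2 * Num.max 0 t).
Proof.
apply: (is_derive_quadratic (K := 1)) => h; rewrite /sqr_pos mul1r ler_norml.
case: (leP 0 t) => t0; case: (leP 0 (h + t)) => ht; apply/andP; split; nra.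
Qed.

Lemma max0_continuous : continuous (fun t : R => Num.max 0 t).
Proof.
by move=> x; apply: (@continuous_max _ _ (fun=> 0) id); [exact: cst_continuous|exact: cvg_id].
Qed.

Definition sqnorm d (x : 'rV[R]_d) : R := \sum_(i < d) x ord0 i ^+ 2.

Lemma sqnorm_line d (x : 'rV[R]_d) i h :
  sqnorm (h *: delta_mx ord0 i + x) = sqnorm x + 2 * x ord0 i * h + h ^+ 2.
Proof.
rewrite /sqnorm (bigD1 i)//= [in RHS](bigD1 i)//= !mxE !eqxx mulr1.
rewrite (eq_bigr (fun j => x ord0 j ^+ 2)); first by ring.
by move=> j ji; rewrite !mxE eqxx (negbTE ji) mulr0 add0r.
Qed.

Lemma coord_le_sqnorm d (x : 'rV[R]_d) i : x ord0 i ^+ 2 <= sqnorm x.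
Proof.
by rewrite /sqnorm (bigD1 i)//= lerDl; apply: sumr_ge0 => j _; exact: sqr_ge0.
Qed.

Lemma sqnorm_ge0 d (x : 'rV[R]_d) : 0 <= sqnorm x.
Proof. by apply: sumr_ge0 => j _; exact: sqr_ge0. Qed.

Lemma C1_sqnorm d : C1 (@sqnorm d) /\ forall i (x : 'rV[R]_d), partial i (@sqnorm d) x = 2 * x ord0 i.
Proof.
have D i (x : 'rV[R]_d) : is_derive x (delta_mx ord0 i) (@sqnorm d) (2 * x ord0 i).
  have dg : is_derive (0 : R) (1 : R) (fun h => sqnorm x + 2 * x ord0 i * h + h ^+ 2) (2 * x ord0 i).
    apply: (is_derive_quadratic (K := 1)) => h.
    by rewrite (_ : _ - _ = h ^+ 2) ?ger0_norm ?sqr_ge0 ?mul1r//; ring.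
  have [l1 l2] := @derive_line R _ _ (@sqnorm d) (fun h => sqnorm x + 2 * x ord0 i * h + h ^+ 2)
    x (delta_mx ord0 i) 0 1
    (fun h => etrans (sqnorm_line x i h) (congr1 (fun t => sqnorm x + 2 * x ord0 i * t + t ^+ 2)
       (esym (etrans (addr0 _) (mulr1 h))))).
  have [D1 D2] := dg.
  by apply: DeriveDef; [exact: l1.2|rewrite l2].
have E i (x : 'rV[R]_d) : partial i (@sqnorm d) x = 2 * x ord0 i.
  exact: (@derive_val _ _ _ _ _ _ _ (D i x)).
split => //; split.
  by apply: continuous_bigsum => i; apply: continuous_sqr; exact: coord_continuous.
move=> i; split; first by move=> x; exact: (@ex_derive _ _ _ _ _ _ _ (D i x)).
rewrite (_ : partial _ _ = fun x : 'rV[R]_d => 2 * x ord0 i); last exact/funext.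
move=> x; apply: (@continuousM _ _ (fun=> 2)); first exact: cst_continuous.
exact: coord_continuous.
Qed.

Variable e : R.
Hypothesis e01 : 0 < e <= 1.

(** Supported in the Euclidean ball of radius 1/e. *)
Definition cutoff d (x : 'rV[R]_d) : R := sqr_pos (1 - e ^+ 2 * sqnorm x).

Lemma C1_cutoff d : C1 (@cutoff d) /\ forall x : 'rV[R]_d, gradsq (@cutoff d) x <= 16 * e ^+ 2.
Proof.
have [e0 e1] := andP e01.
have [C1n nE] := C1_sqnorm d.
have [C1c cE] : C1 (@cutoff d) /\ forall i x, partial i (@cutoff d) x =
    (- e ^+ 2 * (2 * Num.max 0 (1 - e ^+ 2 * sqnorm x))) * partial i (@sqnorm d) x.
  have d1 (t : R) : is_derive t (1 : R) (fun t => 1 - e ^+ 2 * t) (- e ^+ 2).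
    apply: (is_derive_quadratic (K := 0)) => h.
    by rewrite (_ : _ - _ = 0) ?normr0 ?mul0r//; ring.
  apply: (C1_comp (phi := fun t => sqr_pos (1 - e ^+ 2 * t))
     (psi := fun t => (- e ^+ 2 * (2 * Num.max 0 (1 - e ^+ 2 * t)))) C1n) => [t|].
    have := @is_derive1_comp R sqr_pos (fun t => 1 - e ^+ 2 * t) t _ _
      (is_derive_sqr_pos (1 - e ^+ 2 * t)) (d1 t).
    by rewrite mulrC.
  do 2 apply: continuousZ.
  move=> t; apply: (@continuous_comp _ _ _ (fun t => 1 - e ^+ 2 * t) (fun t => Num.max 0 t)).
    exact: (is_derive_continuous d1).
  exact: max0_continuous.
split => // x.
pose m := Num.max 0 (1 - e ^+ 2 * sqnorm x).
have -> : gradsq (@cutoff d) x = 16 * e ^+ 2 * (m ^+ 2 * (e ^+ 2 * sqnorm x)).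
  rewrite /gradsq /sqnorm !mulr_sumr; apply: eq_bigr => i _.
  by rewrite cE nE -/m; ring.
apply: ler_piMr; first by rewrite mulr_ge0// sqr_ge0.
have n0 : 0 <= e ^+ 2 * sqnorm x by rewrite mulr_ge0 ?sqr_ge0 ?sqnorm_ge0.
rewrite /m; case: (leP 0 (1 - e ^+ 2 * sqnorm x)) => h; last by rewrite expr0n mul0r.
by set a := e ^+ 2 * sqnorm x in n0 h *; nra.
Qed.

Lemma cutoff01 d (x : 'rV[R]_d) : 0 <= cutoff x <= 1.
Proof.
have n0 : 0 <= e ^+ 2 * sqnorm x by rewrite mulr_ge0 ?sqr_ge0 ?sqnorm_ge0.
rewrite /cutoff /sqr_pos sqr_ge0/=; set a := e ^+ 2 * _ in n0 *.
by case: (leP 0 (1 - a)) => h; nra.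
Qed.

Lemma cutoff_supp d (x : 'rV[R]_d) : (exists i, e^-1 < `|x ord0 i|) -> cutoff x = 0.
Proof.
have [e0 e1] := andP e01.
move=> [i xi]; rewrite /cutoff /sqr_pos max_l ?expr0n// subr_le0.
have x1 : 1 <= e * `|x ord0 i| by rewrite -ler_pdivrMl// mulr1 ltW.
apply: (@le_trans _ _ ((e * `|x ord0 i|) ^+ 2)); first by rewrite exprn_ege1.
by rewrite exprMn real_normK ?num_real// ler_wpM2l ?sqr_ge0// coord_le_sqnorm.
Qed.

End cutoff.

Section trunc.
Context {R : realType}.
Variables (e b : R).
Hypothesis e01 : 0 < e <= 1.
Hypothesis b01 : 0 <= b <= 2^-1.

(** trunc_sqr is bounded by both z^2 and 1/e and increases to z^2 as e tends
    to 0; trunc_weight z is then a truncation of z ln(exp(1) + z^2)^b.  It is used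
    with b = (1 - tau)/2, where the square of the limit is
    z^2 ln(exp(1) + z^2)^(1 - tau), and with b = 0, where it is z itself. *)
Definition trunc_sqr (z : R) : R := z ^+ 2 / (1 + e * z ^+ 2).
Definition trunc_ln (z : R) : R := ln (expR 1 + trunc_sqr z).
Definition trunc_weight (z : R) : R := z * trunc_ln z `^ b.

Let den_gt0 (z : R) : 0 < 1 + e * z ^+ 2.
Proof. by have [e0 _] := andP e01; rewrite ltr_pwDl// mulr_ge0 ?sqr_ge0 ?ltW. Qed.

Lemma trunc_sqr_ge0 z : 0 <= trunc_sqr z.
Proof. by rewrite /trunc_sqr divr_ge0 ?sqr_ge0// ltW. Qed.

Lemma trunc_sqr_le z : trunc_sqr z <= z ^+ 2.
Proof.
have [e0 _] := andP e01.
by rewrite /trunc_sqr ler_pdivrMr// ler_peMr ?sqr_ge0// lerDl mulr_ge0 ?sqr_ge0 ?ltW.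
Qed.

Lemma trunc_sqr_leV z : trunc_sqr z <= e^-1.
Proof.
have [e0 _] := andP e01.
by rewrite /trunc_sqr ler_pdivrMr// mulrDr mulrA mulVf ?gt_eqF// mul1r lerDr mulr1 invr_ge0 ltW.
Qed.

Lemma expR1_ge1 : 1 <= expR 1 :> R.
Proof. by rewrite -[leLHS]expR0 ler_expR. Qed.

Let eq_gt0 z : 0 < expR 1 + trunc_sqr z.
Proof. by rewrite ltr_pwDl ?expR_gt0 ?trunc_sqr_ge0. Qed.

Lemma lne_ge1 (y : R) : 0 <= y -> 1 <= ln (expR 1 + y).
Proof.
move=> y0; have := ler_ln (R := R); rewrite -[leLHS](expRK 1) => ->.
- by rewrite lerDl.
- by rewrite posrE expR_gt0.
- by rewrite posrE ltr_pwDl ?expR_gt0.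
Qed.

Lemma trunc_ln_ge1 z : 1 <= trunc_ln z.
Proof. by apply: lne_ge1; exact: trunc_sqr_ge0. Qed.

Lemma trunc_ln_le z : trunc_ln z <= ln (expR 1 + z ^+ 2).
Proof.
rewrite /trunc_ln ler_ln ?posrE ?lerD2l ?trunc_sqr_le//.
by rewrite ltr_pwDl ?expR_gt0 ?sqr_ge0.
Qed.

Lemma trunc_ln_leV z : trunc_ln z <= 1 + e^-1.
Proof.
apply: (@le_trans _ _ (ln (expR 1 * (1 + trunc_sqr z)))).
  rewrite /trunc_ln ler_ln ?posrE//.
    rewrite mulrDr mulr1 lerD2l ler_peMl ?trunc_sqr_ge0//; exact: expR1_ge1.
  by rewrite mulr_gt0 ?expR_gt0// ltr_pwDl ?trunc_sqr_ge0.
rewrite lnM ?posrE ?expR_gt0 ?expRK ?ltr_pwDl ?trunc_sqr_ge0// lerD2l.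
by apply: le_trans (trunc_sqr_leV z); apply: le_ln1Dx; apply: lt_le_trans (trunc_sqr_ge0 z).
Qed.

Definition trunc_sqr' (z : R) : R := 2 * z / (1 + e * z ^+ 2) ^+ 2.
Definition trunc_weight' (z : R) : R :=
  trunc_ln z `^ b + z * (b * trunc_ln z `^ (b - 1) * (trunc_sqr' z / (expR 1 + trunc_sqr z))).

Lemma is_derive_trunc_sqr z : is_derive z (1 : R) trunc_sqr (trunc_sqr' z).
Proof.
have dd : is_derive z (1 : R) (fun z => 1 + e * z ^+ 2) (2 * e * z).
  apply: (is_derive_quadratic (K := e)) => h.
  rewrite (_ : _ - _ = e * h ^+ 2); last by ring.
  rewrite ger0_norm//; apply: mulr_ge0; last exact: sqr_ge0.
  by have [? _] := andP e01; exact: ltW.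
have dn : is_derive z (1 : R) (fun z => z ^+ 2) (2 * z).
  apply: (is_derive_quadratic (K := 1)) => h.
  by rewrite (_ : _ - _ = h ^+ 2) ?ger0_norm ?mul1r ?sqr_ge0//; ring.
have dv := @is_deriveV _ _ z _ _ (lt0r_neq0 (den_gt0 z)) dd.
have := @is_deriveM _ _ _ _ z 1 _ _ dn dv.
rewrite /trunc_sqr' /GRing.scale/= => D.
rewrite (_ : _ / _ = z ^+ 2 * (- (1 + e * z ^+ 2) ^- 2 * (2 * e * z)) +
   (1 + e * z ^+ 2)^-1 * (2 * z)) //.
by field; rewrite gt_eqF.
Qed.

Lemma is_derive_trunc_ln z : is_derive z (1 : R) trunc_ln (trunc_sqr' z / (expR 1 + trunc_sqr z)).
Proof.
have dn : is_derive z (1 : R) (fun z => expR 1 + trunc_sqr z) (trunc_sqr' z).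
  have := @is_deriveD _ _ _ (cst (expR 1 : R)) trunc_sqr z 1 _ _ (is_derive_cst _ _ _) (is_derive_trunc_sqr z).
  by rewrite add0r.
have := @is_derive1_comp R (@ln R) (fun z => expR 1 + trunc_sqr z) z _ _ (is_derive1_ln (eq_gt0 z)) dn.
by rewrite mulrC.
Qed.

Lemma is_derive_trunc_weight z : is_derive z (1 : R) trunc_weight (trunc_weight' z).
Proof.
have w0 : 0 < trunc_ln z by exact: lt_le_trans (trunc_ln_ge1 z).
have d1 := @is_derive1_comp R (@powR R ^~ b) trunc_ln z _ _ (is_derive1_powR b w0) (is_derive_trunc_ln z).
have := @is_deriveM _ _ _ _ z 1 _ _ (is_derive_id _ _) d1.
by rewrite /trunc_weight' /GRing.scale/= mulr1 addrC.
Qed.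

(** The derivative of the logarithm times z is at most
    2 q / (exp(1) + q) <= 2, where q = trunc_sqr z; as b <= 1/2 and the
    logarithm is at least 1, the second term of the derivative is bounded by
    the first. *)
Lemma trunc_weight'_sqr_le z : trunc_weight' z ^+ 2 <= 4 * (trunc_ln z `^ b * trunc_ln z `^ b).
Proof.
have [b0 b1] := andP b01.
have w1 := trunc_ln_ge1 z; set w := trunc_ln z in w1 *.
have w0 : 0 < w by exact: lt_le_trans w1.
have wb : 0 <= w `^ (b - 1) <= w `^ b.
  by rewrite powR_ge0/=; apply: ler_powR => //; lra.
have q0 := trunc_sqr_ge0 z.
have r2 : 0 <= z * (trunc_sqr' z / (expR 1 + trunc_sqr z)) <= 2.
  have E0 := expR_gt0 (1 : R).
  have [e0 _] := andP e01.
  have -> : z * (trunc_sqr' z / (expR 1 + trunc_sqr z)) =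
      2 * (trunc_sqr z / (expR 1 + trunc_sqr z) / (1 + e * z ^+ 2)).
    rewrite [X in 2 * (X / _ / _)]/trunc_sqr /trunc_sqr'.
    have := eq_gt0 z; have := den_gt0 z; set Q := expR 1 + _; set D := 1 + _ => D0 Q0.
    by field; rewrite !gt_eqF.
  have qE : 0 <= trunc_sqr z / (expR 1 + trunc_sqr z) <= 1.
    rewrite divr_ge0//=; last exact: ltW.
    by rewrite ler_pdivrMr// mul1r lerDr ltW.
  have [qE0 qE1] := andP qE.
  apply/andP; split; first by rewrite mulr_ge0// divr_ge0// ltW.
  rewrite ler_piMr// ler_pdivrMr// mul1r (le_trans qE1)// lerDl.
  by rewrite mulr_ge0 ?sqr_ge0// ltW.
have -> : trunc_weight' z = w `^ b + b * w `^ (b - 1) * (z * (trunc_sqr' z / (expR 1 + trunc_sqr z))).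
  by rewrite /trunc_weight' -/w; ring.
have [y0 y2] := andP r2; have [p0 pw] := andP wb.
set y := z * _ in y0 y2 *; set p := w `^ (b - 1) in p0 pw *; set W := w `^ b in pw *; clearbody y p W.
have W0 : 0 <= W by exact: le_trans pw.
have : 0 <= b * p * y <= W.
  rewrite !mulr_ge0//=.
  apply: (@le_trans _ _ (2^-1 * p * 2)); last by lra.
  apply: ler_pM => //; first by rewrite mulr_ge0.
  by rewrite ler_wpM2r.
move=> /andP[h0 h1]; rewrite (_ : 4 * (W * W) = (2 * W) ^+ 2); last by ring.
by rewrite ler_sqr ?nnegrE//; lra.
Qed.

Lemma trunc_weight_sqr z : trunc_weight z ^+ 2 = z ^+ 2 * trunc_ln z `^ (2 * b).
Proof.
have w0 : trunc_ln z != 0 by rewrite gt_eqF// (lt_le_trans _ (trunc_ln_ge1 z)).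
rewrite /trunc_weight exprMn; congr *%R.
by rewrite mulr_natl mulr2n powRD ?w0 ?implybT// expr2.
Qed.

Lemma continuous_trunc_weight' : continuous trunc_weight'.
Proof.
have ctq : continuous trunc_sqr by exact: (is_derive_continuous is_derive_trunc_sqr).
have ctw : continuous trunc_ln by exact: (is_derive_continuous is_derive_trunc_ln).
have cpow (c : R) : continuous (fun z => trunc_ln z `^ c).
  apply: (@is_derive_continuous _ _ (fun z => c * trunc_ln z `^ (c - 1) * (trunc_sqr' z / (expR 1 + trunc_sqr z)))) => z.
  have w0 : 0 < trunc_ln z by exact: lt_le_trans (trunc_ln_ge1 z).
  exact: (@is_derive1_comp R (@powR R ^~ c) trunc_ln z _ _ (is_derive1_powR c w0) (is_derive_trunc_ln z)).
have csq : continuous (fun z : R => z ^+ 2) by exact: exprn_continuous.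
have cV (f : R -> R) : (forall z, f z != 0) -> continuous f -> continuous (fun z => (f z)^-1).
  by move=> f0 cf z; apply: continuousV => //; exact: cf.
have cMM (f g : R -> R) : continuous f -> continuous g -> continuous (fun z => f z * g z).
  by move=> cf cg z; apply: continuousM; [exact: cf|exact: cg].
have cD (f g : R -> R) : continuous f -> continuous g -> continuous (fun z => f z + g z).
  by move=> cf cg z; apply: continuousD; [exact: cf|exact: cg].
have cden : continuous (fun z : R => 1 + e * z ^+ 2).
  by apply: (cD (fun=> 1)); [exact: cst_continuous|exact: continuousZ].
apply: (cD (fun z => trunc_ln z `^ b)); first exact: cpow.
apply: (cMM id); first by move=> z; exact: cvg_id.
apply: (cMM (fun z => b * trunc_ln z `^ (b - 1))); first exact: continuousZ.
apply: (cMM trunc_sqr').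
  apply: (cMM (fun z => 2 * z)); first by apply: (@continuousZ _ 2 id) => z; exact: cvg_id.
  apply: (cV (fun z => (1 + e * z ^+ 2) ^+ 2)).
    by move=> z; rewrite expf_neq0// gt_eqF.
  by under eq_fun do rewrite expr2; exact: cMM.
apply: (cV (fun z => expR 1 + trunc_sqr z)); first by move=> z; rewrite gt_eqF.
by apply: (cD (fun=> expR 1)) => //; exact: cst_continuous.
Qed.

End trunc.

Section test.
Context {R : realType} {d : nat}.

(** The error made by the cutoff is f^2 ln(..)^(2b) |grad cutoff|^2, at most
    f^2 (1 + 1/e) 16 e^2, which is bounded by a multiple of f^2 uniformly in e:
    this is why the truncation of the logarithm and the cutoff share the
    parameter e. *)
Lemma test_function (f : 'rV[R]_d -> R) (e b : R) : C1 f -> 0 < e <= 1 -> 0 <= b <= 2^-1 ->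
  let u := fun x => cutoff e x * trunc_weight e b (f x) in
  [/\ C1 u, bsupp u,
    forall x, u x ^+ 2 = cutoff e x ^+ 2 * (f x ^+ 2 * trunc_ln e (f x) `^ (2 * b)) &
    forall x, gradsq u x <= 8 * (gradsq f x * ln (expR 1 + f x ^+ 2) `^ (2 * b)) + 64 * f x ^+ 2].
Proof.
move=> C1f e01 b01 u; have [e0 e1] := andP e01; have [b0 b1] := andP b01.
have [C1c gc] := C1_cutoff e01 d.
have [C1h hE] := C1_comp C1f (is_derive_trunc_weight b e01) (@continuous_trunc_weight' R e b e01).
have [C1u uE] := C1_mul C1c C1h.
have w1 x := trunc_ln_ge1 e01 (f x).
split => //.
- split; first by case: C1u.
  by exists e^-1 => x xe; rewrite /u cutoff_supp// mul0r.
- by move=> x; rewrite /u exprMn trunc_weight_sqr.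
move=> x; set L := ln _ `^ _.
pose W := trunc_ln e (f x) `^ (2 * b).
have W0 : 0 <= W by exact: powR_ge0.
have WL : W <= L.
  apply: ge0_ler_powR; first by rewrite mulr_ge0.
  - by rewrite nnegrE (le_trans ler01).
  - by rewrite nnegrE (le_trans ler01)// lne_ge1// sqr_ge0.
  - exact: trunc_ln_le.
(* balance between the size of the truncated logarithm and the cutoff *)
have We : e ^+ 2 * W <= 2.
  have : W <= 1 + e^-1.
    rewrite (le_trans _ (trunc_ln_leV e01 (f x)))// ler1_powR//.
    by rewrite -ler_pdivlMl// mulr1.
  move=> /(ler_wpM2l (sqr_ge0 e)) /le_trans; apply.
  rewrite mulrDr mulr1 expr2 -mulrA mulfV ?gt_eqF// mulr1.
  by have := mulr_ile1 (ltW e0) (ltW e0) e1 e1; lra.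
have hW : trunc_weight' e b (f x) ^+ 2 <= 4 * W.
  have w0 : trunc_ln e (f x) != 0 by rewrite gt_eqF// (lt_le_trans _ (w1 x)).
  by rewrite /W (_ : 2 * b = b + b) ?powRD ?w0 ?implybT//; [exact: trunc_weight'_sqr_le|ring].
have [c0 c1] := andP (cutoff01 e x).
have c2 : cutoff e x ^+ 2 <= 1 by rewrite expr_le1.
apply: (@le_trans _ _ (2 * (cutoff e x ^+ 2 * trunc_weight' e b (f x) ^+ 2) * gradsq f x +
   2 * trunc_weight e b (f x) ^+ 2 * gradsq (@cutoff _ e d) x)).
  rewrite /gradsq !mulr_sumr -big_split/= ler_sum// => i _.
  rewrite uE hE /= -subr_ge0.
  set c := cutoff e x; set h' := trunc_weight' _ _ _; set h := trunc_weight _ _ _; set p := partial i f x; set q := partial i _ x.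
  by rewrite (_ : _ - _ = (c * h' * p - h * q) ^+ 2) ?sqr_ge0//; ring.
have g0 := gradsq_ge0 f x.
apply: lerD.
  rewrite (_ : 8 * _ = 8 * L * gradsq f x); last by ring.
  apply: ler_wpM2r => //.
  have : cutoff e x ^+ 2 * trunc_weight' e b (f x) ^+ 2 <= 1 * (4 * W).
    by apply: ler_pM => //; exact: sqr_ge0.
  lra.
rewrite trunc_weight_sqr// -/W.
apply: (@le_trans _ _ (2 * (f x ^+ 2 * W) * (16 * e ^+ 2))).
  by apply: ler_wpM2l (gc x); rewrite mulr_ge0//; apply: mulr_ge0 => //; exact: sqr_ge0.
rewrite (_ : _ * _ = 32 * f x ^+ 2 * (e ^+ 2 * W)); last by ring.
rewrite (_ : 64 * _ = 32 * f x ^+ 2 * 2); last by ring.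
by apply: ler_wpM2l => //; rewrite mulr_ge0// sqr_ge0.
Qed.

End test.

(** * Removing the cutoff *)

Section lim.
Context {R : realType}.

Lemma fatou_bound dd (T : measurableType dd) (m : {measure set T -> \bar R})
    (F : nat -> T -> R) (G : T -> R) (K : \bar R) :
  (forall n, measurable_fun setT (F n)) -> (forall n x, 0 <= F n x) ->
  (forall x, F n x @[n --> \oo] --> G x) ->
  (forall n, (\int[m]_x (F n x)%:E <= K)%E) -> (\int[m]_x (G x)%:E <= K)%E.
Proof.
move=> mF F0 FG FK.
have -> : (\int[m]_x (G x)%:E = \int[m]_x limn_einf (fun n => (F n x)%:E))%E.
  apply: eq_integral => x _; apply/esym.
  have /cvg_limn_einf_sup[]// : (F n x)%:E @[n --> \oo] --> (G x)%:E.
  by apply: cvg_EFin; [exact: nearW|exact: FG].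
apply: (@le_trans _ _ (limn_einf (fun n => \int[m]_x (F n x)%:E))%E).
  apply: (@fatou _ _ _ m setT measurableT (fun n x => (F n x)%:E)) => //.
    by move=> n; exact/measurable_EFinP.
  by move=> n x _; rewrite lee_fin.
rewrite limn_einf_lim; apply: lime_le; first exact: is_cvg_einfs.
apply: nearW => n; apply: ge_ereal_inf; exists (\int[m]_x (F n x)%:E)%E; last exact: FK.
by exists n => /=.
Qed.

Lemma trunc_ln_cvg (e : nat -> R) (z : R) : e n @[n --> \oo] --> (0 : R) ->
  trunc_ln (e n) z @[n --> \oo] --> ln (expR 1 + z ^+ 2).
Proof.
move=> e0; rewrite /trunc_ln.
apply: (@continuous_cvg _ _ _ _ _ _ (@ln R)).
  by apply: continuous_ln; rewrite ltr_pwDl ?expR_gt0 ?sqr_ge0.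
apply: cvgD; first exact: cvg_cst.
rewrite /trunc_sqr -[X in _ --> X](_ : z ^+ 2 / (1 + 0 * z ^+ 2) = _); last first.
  by rewrite mul0r addr0 divr1.
apply: cvgM; first exact: cvg_cst.
apply: cvgV; first by rewrite mul0r addr0 oner_neq0.
apply: cvgD; first exact: cvg_cst.
by apply: cvgM => //; exact: cvg_cst.
Qed.

Lemma cutoff_cvg d (e : nat -> R) (x : 'rV[R]_d) : e n @[n --> \oo] --> (0 : R) ->
  cutoff (e n) x @[n --> \oo] --> (1 : R).
Proof.
move=> e0; rewrite /cutoff -[X in _ --> X](_ : sqr_pos (1 - 0 ^+ 2 * sqnorm x) = _); last first.
  by rewrite expr0n mul0r subr0 /sqr_pos max_r// expr1n.
apply: (@continuous_cvg _ _ _ _ _ _ (@sqr_pos R)).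
  exact: (is_derive_continuous (@is_derive_sqr_pos R)).
apply: cvgB; first exact: cvg_cst.
apply: cvgM; last exact: cvg_cst.
by rewrite expr2; under eq_fun do rewrite expr2; exact: cvgM.
Qed.

Lemma powR_cvg (a : R) (w : nat -> R) (l : R) : 0 < l -> w n @[n --> \oo] --> l ->
  w n `^ a @[n --> \oo] --> l `^ a.
Proof.
move=> l0 wl; apply: (@continuous_cvg _ _ _ _ _ _ (fun z => z `^ a)) => //.
apply: differentiable_continuous; apply/derivable1_diffP.
exact: (@ex_derive _ _ _ _ _ _ _ (is_derive1_powR a l0)).
Qed.

Definition eps (n : nat) : R := n.+1%:R^-1.

Lemma eps01 n : 0 < eps n <= 1.
Proof. by rewrite /eps invr_gt0 ltr0n/= invf_le1 ?ler1n ?ltr0n. Qed.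

Lemma eps_cvg : eps n @[n --> \oo] --> (0 : R).
Proof. exact: cvg_harmonic. Qed.

End lim.

(** * Estimates for the measure mu *)

Definition log_density {R : realType} {d} (V f : 'rV[R]_d -> R) (x : 'rV[R]_d) : R :=
  ln (1 + f x ^+ 2 * expR (- V x)).

Section main.
Context {R : realType} {d : nat}.
Implicit Types (f g u : 'rV[R]_d -> R).
Variables (V : 'rV[R]_d -> R) (mu : probability 'rV[R]_d R) (s t C tau : R).
Hypothesis muE : forall A : set 'rV[R]_d, measurable A ->
    mu A = (\int[lebesgue_rV R d]_(x in A) (expR (- V x))%:E)%E.
Hypothesis V2 : class_C 2 V.
Hypotheses (s0 : 0 < s) (t01 : 0 < t < 1) (tau01 : 0 < tau <= 1).
Hypothesis drift : forall x,
    s * Num.max (V x) 1 `^ tau <=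
    (1 - t) * enorm (gradient V x) ^+ 2 - laplacian V x + C.
Let lam := lebesgue_rV R d.
Local Notation M := (drift_weight V tau).
Local Notation l := (log_density V).

Let C1V : C1 V. Proof. exact: class_C1 V2. Qed.
Let t0 : 0 < t. Proof. by case/andP: t01. Qed.
Let mV : measurable_fun setT V. Proof. by apply: continuous_measurable_rV; case: C1V. Qed.
Let mM : measurable_fun setT M. Proof. exact: measurable_drift_weight V2. Qed.
Let mexpV : measurable_fun setT (fun x => expR (- V x)).
Proof.
apply: measurableT_comp => //; exact: measurableT_comp.
Qed.

Lemma log_density_ge0 f x : 0 <= l f x.
Proof. by rewrite ln_ge0// lerDl mulr_ge0 ?sqr_ge0 ?expR_ge0. Qed.

Lemma measurable_log_density f : measurable_fun setT f -> measurable_fun setT (l f).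
Proof.
move=> mf; apply: measurableT_comp => //; apply: measurable_funD => //.
by apply: measurable_funM => //; exact: measurable_funX.
Qed.

Lemma integral_mu f : measurable_fun setT f -> (forall x, 0 <= f x) ->
  (\int[mu]_x (f x)%:E = \int[lam]_x (f x * expR (- V x))%:E)%E.
Proof.
move=> mf f0; have h0 x : 0 <= expR (- V x) by exact: expR_ge0.
apply: (@ge0_integral_density _ _ _ lam mu _ mexpV h0 muE).
  exact/measurable_EFinP.
by move=> x; rewrite lee_fin.
Qed.

Lemma drift_integral (u : 'rV[R]_d -> R) : C1 u -> bsupp u ->
  (\int[mu]_x (u x ^+ 2 * (s * M x + t / 2 * gradsq V x))%:E <=
   \int[mu]_x (`|C| * u x ^+ 2 + 2 / t * gradsq u x)%:E)%E /\
  (\int[mu]_x (`|C| * u x ^+ 2 + 2 / t * gradsq u x)%:E < +oo)%E.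
Proof.
move=> C1u ccu.
have mu' := C1_measurable C1u; have mg := C1_measurable_gradsq C1u.
have mgV := C1_measurable_gradsq C1V.
have B0 x : 0 <= `|C| * u x ^+ 2 + 2 / t * gradsq u x.
  by rewrite addr_ge0// mulr_ge0 ?sqr_ge0 ?gradsq_ge0// divr_ge0// ltW.
have mB : measurable_fun setT (fun x => `|C| * u x ^+ 2 + 2 / t * gradsq u x).
  by apply: measurable_funD; apply: measurable_funM => //; exact: measurable_funX.
split.
  rewrite !integral_mu//.
  - exact: (drift_lebesgue V2 s0 t01 drift).
  - apply: measurable_funM; first exact: measurable_funX.
    by apply: measurable_funD; apply: measurable_funM.
  - move=> x; rewrite mulr_ge0 ?sqr_ge0// addr_ge0// mulr_ge0 ?powR_ge0 ?gradsq_ge0//.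
      exact: ltW.
    by rewrite divr_ge0// ltW.
rewrite integral_mu//.
suff : (\int[lam]_x ((`|C| * u x ^+ 2 + 2 / t * gradsq u x) * expR (- V x))%:E)%E \is a fin_num.
  by rewrite fin_num_abs => /(le_lt_trans (lee_abs _)).
by apply: bsupp_fin_num; exact: bsupp_energy.
Qed.

Definition lsi_const : R := 2 + `|C| / t + 2 / t ^+ 2.

Lemma lsi_const_ge0 : 0 <= lsi_const.
Proof.
by rewrite /lsi_const !addr_ge0// divr_ge0// ?sqr_ge0// ltW.
Qed.

(** The logarithmic Sobolev inequality for g = u e^(-V/2).  As the mass N of g is
    at most 1, N ln(1 + N) is at most the mass; grad g involves u grad V, which
    drift_integral controls. *)
Lemma cutoff_lsi (u : 'rV[R]_d -> R) : C1 u -> bsupp u -> (\int[mu]_x (u x ^+ 2)%:E <= 1)%E ->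
  (\int[mu]_x (u x ^+ 2 * l u x)%:E <= \int[mu]_x (lsi_const * (u x ^+ 2 + gradsq u x))%:E)%E.
Proof.
move=> C1u ccu E1.
have mu' := C1_measurable C1u; have mg := C1_measurable_gradsq C1u.
have mgV := C1_measurable_gradsq C1V.
have mu2 : measurable_fun setT (fun x => u x ^+ 2) by exact: measurable_funX.
(* the ground state: h^2 is the density of mu *)
pose h x := expR (- 2^-1 * V x).
have [C1h hE] : C1 h /\ forall i x, partial i h x = - 2^-1 * h x * partial i V x.
  have dh (a : R) : is_derive a (1 : R) (fun a => expR (- 2^-1 * a)) (- 2^-1 * expR (- 2^-1 * a)).
    have d1 : is_derive a (1 : R) (fun a => - 2^-1 * a) (- 2^-1).
      apply: (is_derive_quadratic (K := 0)) => k.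
      by rewrite (_ : _ - _ = 0) ?normr0 ?mul0r//; ring.
    have := @is_derive1_comp R expR (fun a => - 2^-1 * a) a _ _ (is_derive_expR _) d1.
    by rewrite mulrC.
  apply: (C1_comp C1V dh); apply: continuousZ.
  exact: (is_derive_continuous dh).
have [C1g gE] := C1_mul C1u C1h.
pose g x := u x * h x.
have h2 x : h x ^+ 2 = expR (- V x).
  by rewrite /h expr2 -expRD; congr expR; field.
have g2 x : g x ^+ 2 = u x ^+ 2 * expR (- V x) by rewrite /g exprMn h2.
have ccg : bsupp g.
  split; first by case: C1g.
  by have [_ [r ur]] := ccu; exists r => x xr; rewrite /g ur// mul0r.
have NE : ((fine (\int[lam]_x (g x ^+ 2)%:E)%E)%:E = \int[lam]_x (g x ^+ 2)%:E)%E.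
  by rewrite fineK//; apply: bsupp_fin_num; exact: bsupp_sqr.
set N := fine _ in NE.
have NEu : (N%:E = \int[mu]_x (u x ^+ 2)%:E)%E.
  rewrite NE integral_mu//; last by move=> x; exact: sqr_ge0.
  by apply: eq_integral => x _; rewrite g2.
have N0 : 0 <= N by rewrite -lee_fin NEu ge0_integral_EFin// => x; exact: sqr_ge0.
have N1 : N <= 1 by rewrite -lee_fin NEu.
have lg := euclidean_lsi C1g ccg NE.
have K10 := lsi_const_ge0.
have -> : (\int[mu]_x (u x ^+ 2 * l u x)%:E =
    \int[lam]_x (g x ^+ 2 * ln (1 + g x ^+ 2))%:E)%E.
  rewrite integral_mu//.
  - by apply: eq_integral => x _; congr EFin; rewrite g2 /l; ring.
  - by apply: measurable_funM => //; exact: measurable_log_density.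
  - by move=> x; rewrite mulr_ge0 ?sqr_ge0 ?log_density_ge0.
apply: (le_trans lg).
pose P x := 2 * gradsq u x + t^-1 * (u x ^+ 2 * (s * M x + t / 2 * gradsq V x)).
have mP2 : measurable_fun setT (fun x => u x ^+ 2 * (s * M x + t / 2 * gradsq V x)).
  by apply: measurable_funM => //; apply: measurable_funD; apply: measurable_funM.
have P20 x : 0 <= u x ^+ 2 * (s * M x + t / 2 * gradsq V x).
  rewrite mulr_ge0 ?sqr_ge0// addr_ge0// mulr_ge0 ?powR_ge0 ?gradsq_ge0//.
    exact: ltW.
  by rewrite divr_ge0// ltW.
have mP : measurable_fun setT P.
  by apply: measurable_funD; apply: measurable_funM.
have g0 x := gradsq_ge0 u x.
have tV0 : 0 <= t^-1 by rewrite invr_ge0 ltW.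
have P0 x : 0 <= P x.
  by rewrite addr_ge0// mulr_ge0.
have gP x : gradsq g x <= P x * expR (- V x).
  rewrite -h2.
  apply: (@le_trans _ _ ((2 * gradsq u x + 2^-1 * u x ^+ 2 * gradsq V x) * h x ^+ 2)).
    rewrite /gradsq !mulr_sumr -big_split/= mulr_suml ler_sum// => i _.
    rewrite gE hE -subr_ge0.
    set a := partial i u x; set b := partial i V x; set c := h x; set v := u x.
    rewrite (_ : _ - _ = c ^+ 2 * (a + 2^-1 * v * b) ^+ 2); last by field.
    by rewrite mulr_ge0 ?sqr_ge0.
  apply: ler_wpM2r; first exact: sqr_ge0.
  have -> : P x = 2 * gradsq u x + 2^-1 * u x ^+ 2 * gradsq V x + t^-1 * (u x ^+ 2 * (s * M x)).
    by rewrite /P; field; rewrite gt_eqF.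
  by rewrite lerDl mulr_ge0// mulr_ge0 ?sqr_ge0// mulr_ge0 ?powR_ge0// ltW.
apply: (@le_trans _ _ (\int[mu]_x (u x ^+ 2)%:E + \int[mu]_x (P x)%:E)%E).
  apply: leeD.
    rewrite -NEu lee_fin ler_piMr// (le_trans (le_ln1Dx _))//.
    by rewrite (lt_le_trans _ N0)// ltrN10.
  rewrite integral_mu//; apply: ge0_le_integral => //.
  - by move=> x _; rewrite lee_fin gradsq_ge0.
  - by apply/measurable_EFinP; exact: C1_measurable_gradsq.
  - by apply/measurable_EFinP; apply: measurable_funM.
  - by move=> x _; rewrite lee_fin.
have mB : measurable_fun setT (fun x => `|C| * u x ^+ 2 + 2 / t * gradsq u x).
  by apply: measurable_funD; apply: measurable_funM.
have B0 x : 0 <= `|C| * u x ^+ 2 + 2 / t * gradsq u x.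
  by rewrite addr_ge0// mulr_ge0 ?sqr_ge0// divr_ge0// ltW.
apply: (@le_trans _ _ (\int[mu]_x (u x ^+ 2)%:E +
   (\int[mu]_x (2 * gradsq u x)%:E + \int[mu]_x (t^-1 * (`|C| * u x ^+ 2 + 2 / t * gradsq u x))%:E))%E).
  apply: leeD2l; rewrite /P integral_EFinD//; [|exact: measurable_funM|exact: measurable_funM|..].
  - apply: leeD2l; rewrite !integral_EFinZ//.
    by rewrite lee_wpmul2l ?lee_fin// (drift_integral C1u ccu).1.
  - by move=> x; rewrite mulr_ge0.
  - by move=> x; rewrite mulr_ge0.
have m1 : measurable_fun setT (fun x => 2 * gradsq u x) by exact: measurable_funM.
have m2 : measurable_fun setT (fun x => t^-1 * (`|C| * u x ^+ 2 + 2 / t * gradsq u x)).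
  exact: measurable_funM.
have p1 x : 0 <= 2 * gradsq u x by rewrite mulr_ge0.
have p2 x : 0 <= t^-1 * (`|C| * u x ^+ 2 + 2 / t * gradsq u x) by rewrite mulr_ge0.
have p3 x : 0 <= u x ^+ 2 by exact: sqr_ge0.
rewrite -(integral_EFinD mu m1 m2 p1 p2) -integral_EFinD//; last 2 first.
- exact: measurable_funD.
- by move=> x; rewrite addr_ge0.
apply: le_integral_EFin.
- by apply: measurable_funD => //; exact: measurable_funD.
- by apply: measurable_funM => //; exact: measurable_funD.
- by move=> x; rewrite !addr_ge0.
move=> x; rewrite /lsi_const -subr_ge0.
rewrite (_ : _ - _ = u x ^+ 2 * (1 + 2 / t ^+ 2) + gradsq u x * (`|C| / t)); last first.
  by field; rewrite gt_eqF.
by rewrite addr_ge0// mulr_ge0 ?sqr_ge0// ?divr_ge0 ?addr_ge0 ?divr_ge0 ?sqr_ge0// ltW.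
Qed.

Definition log_weight f x : R := ln (expR 1 + f x ^+ 2) `^ (1 - tau).

Lemma lnf_ge1 f x : 1 <= ln (expR 1 + f x ^+ 2).
Proof. by apply: lne_ge1; exact: sqr_ge0. Qed.

Let tau0 : 0 < tau. Proof. by case/andP: tau01. Qed.
Let tau1 : tau <= 1. Proof. by case/andP: tau01. Qed.

Lemma log_weight_ge1 f x : 1 <= log_weight f x.
Proof.
rewrite /log_weight -[leLHS](powRr0 (ln (expR 1 + f x ^+ 2))).
by apply: ler_powR; [exact: lnf_ge1|rewrite subr_ge0].
Qed.

Lemma measurable_lnf f : measurable_fun setT f ->
  measurable_fun setT (fun x => ln (expR 1 + f x ^+ 2)).
Proof.
move=> mf; apply: measurableT_comp => //; apply: measurable_funD => //.
exact: measurable_funX.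
Qed.

Lemma measurable_log_weight f : measurable_fun setT f -> measurable_fun setT (log_weight f).
Proof.
move=> mf; rewrite /log_weight; apply: (measurableT_comp (measurable_powR _)).
exact: measurable_lnf.
Qed.

(** Limit of cutoff_lsi along cutoffs of f, the exponent 0 turning the truncation
    into the identity. *)
Lemma log_density_bound f : C1 f -> (\int[mu]_x (f x ^+ 2)%:E = 1)%E ->
  (\int[mu]_x (f x ^+ 2 * l f x)%:E <= \int[mu]_x (lsi_const * (65 * f x ^+ 2 + 8 * gradsq f x))%:E)%E.
Proof.
move=> C1f E1.
have mf := C1_measurable C1f; have mg := C1_measurable_gradsq C1f.
have mf2 : measurable_fun setT (fun x => f x ^+ 2) by exact: measurable_funX.
pose u n x := cutoff (eps n) x * trunc_weight (eps n) 0 (f x).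
have b01 : 0 <= (0 : R) <= 2^-1 by rewrite lexx invr_ge0 ler0n.
have uP n := test_function C1f (eps01 n) b01.
have uE n x : u n x ^+ 2 = cutoff (eps n) x ^+ 2 * f x ^+ 2.
  by have [_ _ -> _] := uP n; rewrite mulr0 powRr0 mulr1.
have uf n x : u n x ^+ 2 <= f x ^+ 2.
  rewrite uE ler_piMl ?sqr_ge0//; have [c0 c1] := andP (cutoff01 (eps n) x).
  by rewrite expr_le1.
have K10 := lsi_const_ge0.
apply: (@fatou_bound R _ _ mu (fun n x => u n x ^+ 2 * l (u n) x)).
- move=> n; have [C1u _ _ _] := uP n.
  have mu' : measurable_fun setT (u n) by exact: C1_measurable.
  by apply: measurable_funM; [exact: measurable_funX|exact: measurable_log_density].
- by move=> n x; rewrite mulr_ge0 ?sqr_ge0 ?log_density_ge0.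
- move=> x; have uc : u n x ^+ 2 @[n --> \oo] --> f x ^+ 2.
    have c := cutoff_cvg x (@eps_cvg R).
    have h : cutoff (eps n) x * cutoff (eps n) x * f x ^+ 2 @[n --> \oo] --> 1 * 1 * f x ^+ 2.
      by apply: cvgM; [exact: cvgM|exact: cvg_cst].
    rewrite !mul1r in h; apply: cvg_trans h; apply: near_eq_cvg.
    by apply: nearW => n; rewrite uE expr2.
  apply: cvgM => //; apply: (@continuous_cvg _ _ _ _ _ _ (@ln R)).
    by apply: continuous_ln; rewrite ltr_pwDl//; apply: mulr_ge0; [exact: sqr_ge0|exact: expR_ge0].
  apply: cvgD; first exact: cvg_cst.
  by apply: cvgM => //; exact: cvg_cst.
- move=> n; have [C1u ccu _ gu] := uP n.
  have mu' : measurable_fun setT (u n) by exact: C1_measurable.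
  have mgu : measurable_fun setT (gradsq (u n)) by exact: C1_measurable_gradsq.
  have mu2 : measurable_fun setT (fun x => u n x ^+ 2) by exact: measurable_funX.
  apply: (le_trans (cutoff_lsi C1u ccu _)).
    rewrite -E1; apply: le_integral_EFin => // x; first exact: sqr_ge0.
    exact: uf.
  apply: le_integral_EFin.
  + by apply: measurable_funM => //; exact: measurable_funD.
  + by apply: measurable_funM => //; apply: measurable_funD; exact: measurable_funM.
  + by move=> x; rewrite mulr_ge0// addr_ge0 ?sqr_ge0 ?gradsq_ge0.
  + move=> x; rewrite ler_wpM2l//.
    have g1 : gradsq (u n) x <= 8 * gradsq f x + 64 * f x ^+ 2.
      by have := gu x; rewrite mulr0 powRr0 mulr1.
    by apply: (le_trans (lerD (uf n x) g1)); lra.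
Qed.

(** From e + f^2 <= e^(1 + max(V,1)) (1 + f^2 e^(-V)). *)
Lemma lnf_le f x : ln (expR 1 + f x ^+ 2) <= 1 + Num.max (V x) 1 + l f x.
Proof.
pose v := Num.max (V x) 1.
have v1 : 1 <= v by rewrite /v le_max lexx orbT.
have Vv : V x <= v by rewrite /v le_max lexx.
have p0 : 0 <= f x ^+ 2 * expR (- V x) by rewrite mulr_ge0 ?sqr_ge0 ?expR_ge0.
have q0 : 0 < 1 + f x ^+ 2 * expR (- V x) by rewrite ltr_pwDl.
rewrite -/v -(expRK (1 + v)) -lnM ?posrE ?expR_gt0// ler_ln ?posrE; last 2 first.
- by rewrite ltr_pwDl ?expR_gt0 ?sqr_ge0.
- by rewrite mulr_gt0 ?expR_gt0.
rewrite mulrDr mulr1 lerD//; first by rewrite ler_expR; lra.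
rewrite mulrCA -expRD ler_peMr ?sqr_ge0// -[leLHS]expR0 ler_expR; lra.
Qed.

(** Above this value of max(V,1) the drift weight exceeds 2 |C| / s. *)
Definition low_level : R := Num.max 1 ((2 * `|C| / s) `^ tau^-1).

(** If the drift weight is at least 2 |C| / s, the left-hand side is at most the
    first term.  Otherwise max(V,1) <= low_level, and lnf_le bounds w. *)
Lemma low_level_absorb f x (w : R) : 1 <= w -> w <= ln (expR 1 + f x ^+ 2) ->
  `|C| * w `^ (1 - tau) <= s / 2 * (M x * w `^ (1 - tau)) + `|C| * (1 + low_level + l f x).
Proof.
move=> w1 wf; have tau_gt0 := tau0; have tau_le1 := tau1.
have W0 : 0 <= w `^ (1 - tau) by exact: powR_ge0.
have V01 : 1 <= low_level by rewrite /low_level le_max lexx.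
have l0 := log_density_ge0 f x.
have [CM|MC] := leP (2 * `|C| / s) (M x).
  apply: (@le_trans _ _ (s / 2 * (M x * w `^ (1 - tau)))); last first.
    by rewrite lerDl mulr_ge0// !addr_ge0//; lra.
  rewrite mulrA ler_wpM2r//; move: CM; rewrite ler_pdivrMr//; lra.
apply: (@le_trans _ _ (`|C| * (1 + low_level + l f x))); last first.
  by rewrite lerDr !mulr_ge0 ?powR_ge0// ltW.
apply: ler_wpM2l => //.
apply: (@le_trans _ _ w); first by rewrite ler1_powR//; lra.
apply: (le_trans wf); apply: (le_trans (lnf_le f x)).
rewrite lerD2r lerD2l.
have v0 : 0 <= Num.max (V x) 1 by rewrite le_max ler01 orbT.
have -> : Num.max (V x) 1 = M x `^ tau^-1 by rewrite /M -powRrM mulfV ?gt_eqF// powRr1.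
apply: (@le_trans _ _ ((2 * `|C| / s) `^ tau^-1)); last by rewrite /low_level le_max lexx orbT.
apply: ge0_ler_powR.
- by rewrite invr_ge0 ltW.
- by rewrite nnegrE powR_ge0.
- by rewrite nnegrE divr_ge0 ?mulr_ge0// ltW.
- exact: (ltW MC).
Qed.

(** What remains of the energy estimate for f L(f)^(1/2) once half of the drift
    weight has been used for the absorption. *)
Definition weight_bound f x : R := `|C| * (f x ^+ 2 * (1 + low_level + l f x)) +
  2 / t * (8 * (gradsq f x * log_weight f x) + 64 * f x ^+ 2).

(** drift_integral for the truncations u n of f L(f)^(1/2), followed by a passage
    to the limit.  The same inequality first shows that the integral of
    (u n)^2 M is finite, so that half of it can be subtracted from both
    sides. *)
Lemma drift_weight_bound f : C1 f ->
  (\int[mu]_x (f x ^+ 2 * (log_weight f x * M x))%:E <= (2 / s)%:E * \int[mu]_x (weight_bound f x)%:E)%E.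
Proof.
move=> C1f; have tau_gt0 := tau0; have tau_le1 := tau1.
have mf := C1_measurable C1f; have mg := C1_measurable_gradsq C1f.
have mf2 : measurable_fun setT (fun x => f x ^+ 2) by exact: measurable_funX.
have mgV := C1_measurable_gradsq C1V.
have b01 : 0 <= (1 - tau) / 2 <= 2^-1 by apply/andP; split; lra.
have bE : 2 * ((1 - tau) / 2) = 1 - tau by field.
pose u n x := cutoff (eps n) x * trunc_weight (eps n) ((1 - tau) / 2) (f x).
have uP n := test_function C1f (eps01 n) b01.
have uE n x : u n x ^+ 2 = cutoff (eps n) x ^+ 2 * (f x ^+ 2 * trunc_ln (eps n) (f x) `^ (1 - tau)).
  by have [_ _ -> _] := uP n; rewrite bE.
have V01 : 1 <= low_level by rewrite /low_level le_max lexx.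
have r0 x : 0 <= weight_bound f x.
  rewrite addr_ge0//.
    by rewrite mulr_ge0// mulr_ge0 ?sqr_ge0// !addr_ge0 ?log_density_ge0//; lra.
  rewrite mulr_ge0//; first by rewrite divr_ge0// ltW.
  by rewrite addr_ge0// mulr_ge0 ?sqr_ge0// mulr_ge0 ?gradsq_ge0 ?powR_ge0.
have mr : measurable_fun setT (weight_bound f).
  apply: measurable_funD; apply: measurable_funM => //.
    by apply: measurable_funM => //; apply: measurable_funD => //; exact: measurable_log_density.
  apply: measurable_funD; apply: measurable_funM => //.
  by apply: measurable_funM => //; exact: measurable_log_weight.
apply: (@fatou_bound R _ _ mu (fun n x => u n x ^+ 2 * M x)).
- move=> n; have [C1u _ _ _] := uP n.
  have mu' : measurable_fun setT (u n) by exact: C1_measurable.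
  by apply: measurable_funM => //; exact: measurable_funX.
- by move=> n x; rewrite mulr_ge0 ?sqr_ge0 ?powR_ge0.
- move=> x; rewrite mulrA; apply: cvgM; last exact: cvg_cst.
  have c := cutoff_cvg x (@eps_cvg R).
  have h : cutoff (eps n) x * cutoff (eps n) x * (f x ^+ 2 * trunc_ln (eps n) (f x) `^ (1 - tau))
      @[n --> \oo] --> 1 * 1 * (f x ^+ 2 * log_weight f x).
    apply: cvgM; first exact: cvgM.
    apply: cvgM; first exact: cvg_cst.
    apply: powR_cvg; last exact: trunc_ln_cvg (@eps_cvg R).
    exact: lt_le_trans (lnf_ge1 f x).
  rewrite !mul1r in h; apply: cvg_trans h; apply: near_eq_cvg.
  by apply: nearW => n; rewrite uE expr2.
- move=> n; have [C1u ccu _ gu] := uP n.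
  have mu' : measurable_fun setT (u n) by exact: C1_measurable.
  have mgu : measurable_fun setT (gradsq (u n)) by exact: C1_measurable_gradsq.
  have mu2 : measurable_fun setT (fun x => u n x ^+ 2) by exact: measurable_funX.
  have muM : measurable_fun setT (fun x => u n x ^+ 2 * M x) by exact: measurable_funM.
  have uM0 x : 0 <= u n x ^+ 2 * M x by rewrite mulr_ge0 ?sqr_ge0 ?powR_ge0.
  have [dr fin] := drift_integral C1u ccu.
  set B := (\int[mu]_x (`|C| * _ + _)%:E)%E in dr fin.
  have s1 : (s%:E * \int[mu]_x (u n x ^+ 2 * M x)%:E <= B)%E.
    apply: le_trans dr; rewrite -integral_EFinZ//; last exact: ltW.
    apply: le_integral_EFin.
    + exact: measurable_funM.
    + by apply: measurable_funM => //; apply: measurable_funD; exact: measurable_funM.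
    + by move=> x; rewrite mulr_ge0// ltW.
    + move=> x; rewrite mulrDr (mulrCA s) lerDl mulr_ge0 ?sqr_ge0// mulr_ge0 ?gradsq_ge0//.
      by rewrite divr_ge0// ltW.
  have s2 : (B <= (s / 2)%:E * \int[mu]_x (u n x ^+ 2 * M x)%:E + \int[mu]_x (weight_bound f x)%:E)%E.
    rewrite -integral_EFinZ//; last by rewrite divr_ge0// ltW.
    rewrite -integral_EFinD//; last 2 first.
    + exact: measurable_funM.
    + by move=> x; rewrite mulr_ge0// divr_ge0// ltW.
    apply: le_integral_EFin.
    + by apply: measurable_funD; exact: measurable_funM.
    + by apply: measurable_funD => //; exact: measurable_funM.
    + move=> x; rewrite addr_ge0// mulr_ge0 ?sqr_ge0 ?gradsq_ge0//.
      by rewrite divr_ge0// ltW.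
    move=> x; rewrite /weight_bound addrA; apply: lerD.
      rewrite uE; set c := cutoff _ _ ^+ 2; set W := _ `^ _.
      have c01 : 0 <= c <= 1.
        have [c0 c1] := andP (cutoff01 (eps n) x).
        by rewrite /c sqr_ge0 expr_le1.
      have [c0 c1] := andP c01.
      have ab := @low_level_absorb f x _ (trunc_ln_ge1 (eps01 n) (f x)) (trunc_ln_le (eps01 n) (f x)).
      rewrite -/W in ab.
      apply: (@le_trans _ _ (c * f x ^+ 2 * (s / 2 * (M x * W) + `|C| * (1 + low_level + l f x)))).
        rewrite (_ : `|C| * _ = c * f x ^+ 2 * (`|C| * W)); last by ring.
        by rewrite ler_wpM2l// mulr_ge0 ?sqr_ge0.
      rewrite mulrDr; apply: lerD.
        by rewrite le_eqVlt; apply/orP; left; apply/eqP; ring.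
      rewrite (_ : c * _ * _ = c * (`|C| * (f x ^+ 2 * (1 + low_level + l f x)))); last by ring.
      rewrite ler_piMl// mulr_ge0// mulr_ge0 ?sqr_ge0// !addr_ge0 ?log_density_ge0//; lra.
    apply: ler_wpM2l; first by rewrite divr_ge0// ltW.
    by have := gu x; rewrite bE.
  have s3 := le_trans s1 s2.
  have Ef : (\int[mu]_x (u n x ^+ 2 * M x)%:E)%E \is a fin_num.
    rewrite ge0_fin_numE ?ge0_integral_EFin//.
    have := le_lt_trans s1 fin.
    case: (\int[mu]_x _)%E => [r||] h; [exact: ltry| |by []].
    by move: h; rewrite gt0_muley.
  suff : (\int[mu]_x (u n x ^+ 2 * M x)%:E <= (2 / s)%:E * \int[mu]_x (weight_bound f x)%:E)%E by [].
  move: s3; rewrite -(fineK Ef); set a := fine _; have := ge0_integral_EFin mu r0.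
  case: (\int[mu]_x (weight_bound f x)%:E)%E => [r r00||]//; last first.
    by move=> _ _; rewrite gt0_muley ?leey// lte_fin divr_gt0.
  rewrite -!EFinM -EFinD !lee_fin => h.
  rewrite -(ler_pM2l s0); apply: (@le_trans _ _ (2 * r)); first lra.
  by rewrite le_eqVlt; apply/orP; left; apply/eqP; field; rewrite gt_eqF.
Qed.

(** If 4 l f x < w, where w is the left-hand side, then lnf_le gives
    3w/4 < 1 + max(V,1) <= 2 max(V,1), hence w <= 3 max(V,1); now write
    w = w^(1 - tau) w^tau and use this bound in the second factor only. *)
Lemma ln_split f x : ln (expR 1 + f x ^+ 2) <= 4 * l f x + 3 * (log_weight f x * M x).
Proof.
have tau_gt0 := tau0; have tau_le1 := tau1.
have w1 := lnf_ge1 f x; have wle := lnf_le f x; have l0 := log_density_ge0 f x.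
rewrite /log_weight; set w := ln _ in w1 wle *.
have LM0 : 0 <= w `^ (1 - tau) * M x by rewrite mulr_ge0 ?powR_ge0.
have [h|h] := leP w (4 * l f x); first lra.
have v1 : 1 <= Num.max (V x) 1 by rewrite le_max lexx orbT.
set v := Num.max _ _ in v1 wle.
have wv : w <= 3 * v by lra.
suff : w <= 3 * (w `^ (1 - tau) * M x) by lra.
have w0 : 0 < w by exact: lt_le_trans w1.
have wE : w = w `^ (1 - tau) * w `^ tau.
  by rewrite -powRD ?(gt_eqF w0) ?implybT// subrK powRr1 ?ltW.
rewrite {1}wE.
apply: (@le_trans _ _ (w `^ (1 - tau) * (3 * M x))); last first.
  by rewrite mulrCA.
apply: ler_wpM2l; first exact: powR_ge0.
apply: (@le_trans _ _ ((3 * v) `^ tau)).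
  by apply: ge0_ler_powR; rewrite ?nnegrE ?ltW//; lra.
rewrite powRM//; last lra.
by apply: ler_wpM2r; [exact: powR_ge0|apply: ler1_powR => //; lra].
Qed.

(** The values produced by inserting log_density_bound and drift_weight_bound
    into ln_split. *)
Definition energy_const : R := 32 * lsi_const + 6 / s * (8 * lsi_const * `|C| + 16 / t).
Definition mass_const : R := 260 * lsi_const +
  6 / s * (`|C| * (1 + low_level) + 65 * lsi_const * `|C| + 128 / t).

Lemma energy_const_gt0 : 0 < energy_const.
Proof.
have K10 : 2 <= lsi_const.
  by rewrite /lsi_const -addrA lerDl addr_ge0// divr_ge0 ?sqr_ge0// ltW.
rewrite /energy_const ltr_pwDl//; first lra.
apply: mulr_ge0; first by rewrite divr_ge0// ltW.
apply: addr_ge0; first by apply: mulr_ge0 => //; lra.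
by rewrite divr_ge0// ltW.
Qed.

Lemma mass_const_gt0 : 0 < mass_const.
Proof.
have K10 : 2 <= lsi_const.
  by rewrite /lsi_const -addrA lerDl addr_ge0// divr_ge0 ?sqr_ge0// ltW.
have V01 : 1 <= low_level by rewrite /low_level le_max lexx.
rewrite /mass_const ltr_pwDl//; first lra.
apply: mulr_ge0; first by rewrite divr_ge0// ltW.
apply: addr_ge0; last by rewrite divr_ge0// ltW.
apply: addr_ge0; first by apply: mulr_ge0 => //; lra.
by rewrite mulr_ge0// mulr_ge0//; lra.
Qed.

(** Integrate ln_split against f^2.  The case of infinite weighted energy is
    trivial because energy_const is positive; otherwise all integrals on the
    right are finite. *)
Lemma entropy_bound f : C1 f -> (\int[mu]_x (f x ^+ 2)%:E = 1)%E ->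
  (\int[mu]_x (f x ^+ 2 * ln (expR 1 + f x ^+ 2))%:E <=
   mass_const%:E + energy_const%:E * \int[mu]_x (gradsq f x * log_weight f x)%:E)%E.
Proof.
move=> C1f E1.
have lsi := log_density_bound C1f E1.
have wl := drift_weight_bound C1f.
have spl := ln_split f.
have mf := C1_measurable C1f; have mg := C1_measurable_gradsq C1f.
have mf2 : measurable_fun setT (fun x => f x ^+ 2) by exact: measurable_funX.
have V01 : 1 <= low_level by rewrite /low_level le_max lexx.
have K10 := lsi_const_ge0.
have mL := measurable_log_weight mf.
have ml : measurable_fun setT (l f) by exact: measurable_log_density.
have f20 x : 0 <= f x ^+ 2 by exact: sqr_ge0.
have l0 x : 0 <= l f x by exact: log_density_ge0.
have L1 x : 1 <= log_weight f x by exact: log_weight_ge1.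
have L0 x : 0 <= log_weight f x by exact: powR_ge0.
have g0 x : 0 <= gradsq f x by exact: gradsq_ge0.
have gL0 x : 0 <= gradsq f x * log_weight f x by rewrite mulr_ge0.
have mgL : measurable_fun setT (fun x => gradsq f x * log_weight f x) by exact: measurable_funM.
have fl0 x : 0 <= f x ^+ 2 * l f x by rewrite mulr_ge0.
have mfl : measurable_fun setT (fun x => f x ^+ 2 * l f x) by exact: measurable_funM.
have fLM0 x : 0 <= f x ^+ 2 * (log_weight f x * M x).
  by rewrite mulr_ge0// mulr_ge0// powR_ge0.
have mfLM : measurable_fun setT (fun x => f x ^+ 2 * (log_weight f x * M x)).
  by apply: measurable_funM => //; exact: measurable_funM.
have I0 : (0 <= \int[mu]_x (gradsq f x * log_weight f x)%:E)%E by exact: ge0_integral_EFin.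
case IE : (\int[mu]_x (gradsq f x * log_weight f x)%:E)%E I0 => [i||]// I0; last first.
  by rewrite gt0_muley ?addey ?leey// lte_fin energy_const_gt0.
have i0 : 0 <= i by rewrite -lee_fin.
have s1 : (\int[mu]_x (f x ^+ 2 * l f x)%:E <= (lsi_const * (65 + 8 * i))%:E)%E.
  apply: (le_trans lsi).
  apply: (@le_trans _ _ (\int[mu]_x (lsi_const * (65 * f x ^+ 2 + 8 * (gradsq f x * log_weight f x)))%:E)%E).
    apply: le_integral_EFin.
    - by apply: measurable_funM => //; apply: measurable_funD; exact: measurable_funM.
    - by apply: measurable_funM => //; apply: measurable_funD; exact: measurable_funM.
    - by move=> x; rewrite mulr_ge0// addr_ge0// mulr_ge0.
    - by move=> x; rewrite ler_wpM2l// lerD2l ler_wpM2l// ler_peMr.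
  rewrite integral_EFinZ//; last 2 first.
  - by apply: measurable_funD; exact: measurable_funM.
  - by move=> x; rewrite addr_ge0// mulr_ge0.
  rewrite integral_EFinD//; last 4 first.
  - exact: measurable_funM.
  - exact: measurable_funM.
  - by move=> x; rewrite mulr_ge0.
  - by move=> x; rewrite mulr_ge0.
  by rewrite !integral_EFinZ// E1 IE mule1; exact: lexx.
have s2 : (\int[mu]_x (weight_bound f x)%:E <= (`|C| * (1 + low_level) + (`|C| * (lsi_const * (65 + 8 * i)) + (16 / t * i + 128 / t)))%:E)%E.
  have wbE x : weight_bound f x = `|C| * (1 + low_level) * f x ^+ 2 +
     (`|C| * (f x ^+ 2 * l f x) + (16 / t * (gradsq f x * log_weight f x) + 128 / t * f x ^+ 2)).
    by rewrite /weight_bound; ring.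
  under eq_integral do rewrite wbE.
  have c0 : 0 <= `|C| * (1 + low_level) by rewrite mulr_ge0//; lra.
  have c1 : 0 <= 16 / t by rewrite divr_ge0// ltW.
  have c2 : 0 <= 128 / t by rewrite divr_ge0// ltW.
  have m1 : measurable_fun setT (fun x => `|C| * (1 + low_level) * f x ^+ 2) by exact: measurable_funM.
  have m2 : measurable_fun setT (fun x => `|C| * (f x ^+ 2 * l f x)) by exact: measurable_funM.
  have m3 : measurable_fun setT (fun x => 16 / t * (gradsq f x * log_weight f x)) by exact: measurable_funM.
  have m4 : measurable_fun setT (fun x => 128 / t * f x ^+ 2) by exact: measurable_funM.
  have n1 x : 0 <= `|C| * (1 + low_level) * f x ^+ 2 by rewrite mulr_ge0.
  have n2 x : 0 <= `|C| * (f x ^+ 2 * l f x) by rewrite mulr_ge0.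
  have n3 x : 0 <= 16 / t * (gradsq f x * log_weight f x) by rewrite mulr_ge0.
  have n4 x : 0 <= 128 / t * f x ^+ 2 by rewrite mulr_ge0.
  have m34 := measurable_funD m3 m4.
  have m234 := measurable_funD m2 m34.
  rewrite integral_EFinD//; last by move=> x; rewrite !addr_ge0.
  rewrite integral_EFinD//; last by move=> x; rewrite !addr_ge0.
  rewrite integral_EFinD// !integral_EFinZ// E1 IE !mule1.
  rewrite !EFinD; apply: leeD => //; apply: leeD; last by rewrite EFinM.
  by rewrite EFinM; apply: lee_wpmul2l; rewrite ?lee_fin.
apply: (@le_trans _ _ (\int[mu]_x (4 * (f x ^+ 2 * l f x) + 3 * (f x ^+ 2 * (log_weight f x * M x)))%:E)%E).
  apply: le_integral_EFin.
  - by apply: measurable_funM => //; exact: measurable_lnf.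
  - by apply: measurable_funD; exact: measurable_funM.
  - by move=> x; rewrite mulr_ge0// (le_trans ler01)// lnf_ge1.
  - move=> x; have := ler_wpM2l (f20 x) (spl x); lra.
have m1 : measurable_fun setT (fun x => 4 * (f x ^+ 2 * l f x)) by exact: measurable_funM.
have m2 : measurable_fun setT (fun x => 3 * (f x ^+ 2 * (log_weight f x * M x))) by exact: measurable_funM.
rewrite integral_EFinD//; last 2 first.
- by move=> x; rewrite mulr_ge0.
- by move=> x; rewrite mulr_ge0.
rewrite !integral_EFinZ//.
have s3 : (\int[mu]_x (f x ^+ 2 * (log_weight f x * M x))%:E <= (2 / s * (`|C| * (1 + low_level) + (`|C| * (lsi_const * (65 + 8 * i)) + (16 / t * i + 128 / t))))%:E)%E.
  apply: (le_trans wl); rewrite [leRHS]EFinM; apply: lee_wpmul2l => //.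
  by rewrite lee_fin divr_ge0// ltW.
apply: (@le_trans _ _ (4%:E * (lsi_const * (65 + 8 * i))%:E + 3%:E * (2 / s * (`|C| * (1 + low_level) + (`|C| * (lsi_const * (65 + 8 * i)) + (16 / t * i + 128 / t))))%:E)%E).
  by apply: leeD; apply: lee_wpmul2l; rewrite ?lee_fin.
rewrite -!EFinM -!EFinD lee_fin /mass_const /energy_const le_eqVlt; apply/orP; left; apply/eqP.
by field; rewrite !gt_eqF.
Qed.

End main.

(** * The theorem *)

Theorem theorem5p28 (R : realType) (d : nat) (V : 'rV[R]_d -> R)
  (mu : probability 'rV[R]_d R)
  (hmu : forall A : set 'rV[R]_d, measurable A ->
    mu A = (\int[lebesgue_rV R d]_(x in A) (expR (- V x))%:E)%E)
  (alpha alpha' tau : R) (halpha : 1 < alpha <= 2)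
  (halpha' : alpha^-1 + alpha'^-1 = 1) (htau : tau = 2 / alpha')
  (hexp : exists2 eta : R, 0 < eta &
    (\int[mu]_x (expR (eta * enorm x `^ alpha))%:E < +oo)%E)
  (hV2 : class_C 2 V)
  (hVlb : exists b : R, forall x, b <= V x)
  (hdrift : exists s t C : R, [/\ 0 < s, 0 < t < 1 & forall x,
    s * Num.max (V x) 1 `^ tau <=
    (1 - t) * enorm (gradient V x) ^+ 2 - laplacian V x + C]) :
  inequality_I mu tau.
Proof.
have tau01 : 0 < tau <= 1.
  have [a1 a2] := andP halpha.
  have a0 : 0 < alpha by lra.
  have i1 : alpha^-1 < 1 by rewrite invf_lt1.
  have i2 : 2^-1 <= alpha^-1 by rewrite lef_pV2 ?posrE.
  by rewrite htau; apply/andP; split; lra.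
have [s [t [C [s0 t01 drift]]]] := hdrift.
have eb := entropy_bound hmu hV2 s0 t01 tau01 drift.
move: (mass_const_gt0 C tau s0 t01) (energy_const_gt0 C s0 t01) eb.
move: (mass_const _ _ _ _) (energy_const _ _ _) => B C' B0 C'0 eb.
exists B, C' => f smf; cbv zeta.
set m := (\int[mu]_x (f x ^+ 2)%:E)%E.
have C1f : C1 f by exact: (@class_C1 _ _ _ 0 (smf 1%N)).
have mf := C1_measurable C1f.
have mf2 : measurable_fun setT (fun x => f x ^+ 2) by exact: measurable_funX.
have J0 : (0 <= \int[mu]_x (enorm (gradient f x) ^+ 2 *
       ln (expR 1 + f x ^+ 2 / fine m) `^ (1 - tau))%:E)%E.
  by apply: integral_ge0 => x _; rewrite lee_fin mulr_ge0 ?sqr_ge0 ?powR_ge0.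
have m0 : (0 <= m)%E by apply: integral_ge0 => x _; rewrite lee_fin sqr_ge0.
(* infinite mass: the right-hand side is infinite as B > 0 *)
have [moo|mr] := eqVneq m +oo%E.
  rewrite {1}moo gt0_muley ?lte_fin// addye ?leey//.
  by rewrite gt_eqF// (lt_le_trans (ltNyr 0))// mule_ge0// lee_fin ltW.
have mfin : m \is a fin_num by rewrite ge0_fin_numE// lt_neqAle mr leey.
have mE : m = (fine m)%:E by rewrite fineK.
have r0 : 0 <= fine m by exact: fine_ge0.
rewrite /Ent -/m; set r := fine m in mE r0 J0 *.
(* zero mass: division by 0 gives 0, so the entropy integrand vanishes *)
have [rz|rn] := eqVneq r 0.
  rewrite [leLHS]integral0_eq; last first.
    by move=> x _; rewrite rz invr0 mulr0 ln0// mulr0.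
  by rewrite adde_ge0// mule_ge0// lee_fin ltW.
have rp : 0 < r by rewrite lt_neqAle eq_sym rn.
(* otherwise apply the estimate to g = f / sqrt r and multiply by r *)
pose c := (Num.sqrt r)^-1.
have c2 : c ^+ 2 = r^-1 by rewrite /c exprVn sqr_sqrtr.
have dc (z : R) : is_derive z (1 : R) (fun z => c * z) c.
  apply: (is_derive_quadratic (K := 0)) => h.
  by rewrite (_ : _ - _ = 0) ?normr0 ?mul0r//; ring.
have cconst : continuous (fun _ : R => c) by move=> z; exact: cvg_cst.
have [C1g gE] := C1_comp C1f dc cconst.
pose g x := c * f x.
have g2 x : g x ^+ 2 = f x ^+ 2 / r by rewrite /g exprMn c2 mulrC.
have gg x : gradsq g x = gradsq f x / r.
  rewrite /gradsq mulr_suml; apply: eq_bigr => i _.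
  by rewrite (gE i x) exprMn c2 mulrC.
have mg : measurable_fun setT g by exact: C1_measurable.
have E1 : (\int[mu]_x (g x ^+ 2)%:E = 1)%E.
  under eq_integral do rewrite g2 mulrC.
  rewrite integral_EFinZ//; last 2 first.
  - by rewrite invr_ge0.
  - by move=> x; exact: sqr_ge0.
  by rewrite -/m mE -EFinM mulVf.
have distr (y : \bar R) :
    (r%:E * (B%:E + C'%:E * y) = B%:E * r%:E + C'%:E * (r%:E * y))%E.
  by rewrite muleDr ?fin_num_adde_defr// muleC [(r%:E * (_ * y))%E]muleCA.
have := eb _ C1g E1.
set X := (\int[mu]_x _)%E; set Y := (\int[mu]_x _)%E => XY.
apply: (@le_trans _ _ (r%:E * X)%E).
  rewrite /X -integral_EFinZ//; last 2 first.
  - apply: measurable_funM; first exact: measurable_funX.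
    exact: measurable_lnf.
  - by move=> x; rewrite mulr_ge0 ?sqr_ge0// (le_trans ler01)// lnf_ge1.
  have rx x : r * (g x ^+ 2 * ln (expR 1 + g x ^+ 2)) = f x ^+ 2 * ln (expR 1 + f x ^+ 2 / r).
    by rewrite g2; field.
  have q0 x : 0 <= f x ^+ 2 / r by rewrite divr_ge0 ?sqr_ge0.
  apply: le_integral_ge0.
  - apply: measurable_funM => //; apply: measurableT_comp => //.
    exact: measurable_funM.
  - apply: measurable_funM => //; apply: measurable_funM; first exact: measurable_funX.
    exact: measurable_lnf.
  - by move=> x; rewrite rx mulr_ge0 ?sqr_ge0// (le_trans ler01)// lne_ge1.
  - move=> x; rewrite rx ler_wpM2l ?sqr_ge0//.
    have [q|q] := leP (f x ^+ 2 / r) 0; first by rewrite ln0// (le_trans ler01)// lne_ge1.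
    by rewrite ler_ln ?posrE// ?lerDr ?expR_ge0// ltr_pwDl ?expR_gt0.
apply: (le_trans (lee_wpmul2l _ XY)); first by rewrite lee_fin.
rewrite distr mE; apply: leeD => //.
apply: lee_wpmul2l; first by rewrite lee_fin ltW.
rewrite /Y -integral_EFinZ//; last 2 first.
- by apply: measurable_funM; [exact: C1_measurable_gradsq|exact: measurable_log_weight].
- by move=> x; rewrite mulr_ge0 ?gradsq_ge0 ?powR_ge0.
rewrite le_eqVlt; apply/orP; left; apply/eqP; apply: eq_integral => x _.
by congr EFin; rewrite /log_weight gg g2 gradsqE; field.
Qed.
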